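(* Let $f(X)\in\mathbb{Z}[X]\setminus\{0\}$ and $\varepsilon_0\in(0,1/100)$ be fixed, and let $C_0$ be the fixed constant depending only on $f$ described in the context. There exist constants $x_0>0$ and $K>0$, depending at most on $f$ and $\varepsilon_0$, such that the following holds for every integer $x\geqslant x_0$. Let $p$ be a prime number, let $t$ be an integer with \[ \left(\frac{10}{\varepsilon_0}\right)^{100} \leqslant t \leqslant C_0 x^{2/3}, \] and let $J$ be an interval with $J\subset[\varepsilon_0 x,\min\{x,p\})$. If $n_1,n_2,\ldots,n_t$ are distinct integers in $J$, then \[ \log p \sum_{t'=\left\lceil \left(\frac{1+\varepsilon_0}{2}\right)t\right\rceil}^{t}\ \min_{1\leqslant j\leqslant t'}\left\{\operatorname{ord}_p\left(n_j!+f(n_j)\right)\right\} \leqslant \frac{|J|}{2}\log t+\frac{x\log x}{t^{0.98}}+Kx. \]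
   Context: $\operatorname{ord}_p(m)$ is the $p$-adic order of a nonzero integer $m$; $|J|$ is the length of the interval $J$; $\log$ is the natural logarithm. For $n$ sufficiently large in terms of $f$ one has $n!+f(n)>1$, so for $x$ large the orders above are finite. The constant $C_0>0$ is a fixed constant depending only on $f$ with the following property (a known result of Luca and Shparlinski guarantees that such a constant exists): for any prime $p$ and any interval $J'\subset[1,p)$ of length $|J'|\geqslant 1$, \[ \#\{n\in\mathbb{N}: n\in J',\ p\mid (n!+f(n))\}\leqslant C_0|J'|^{2/3}. \] *)

(* Defs.v *)
From mathcomp Require Import all_boot all_order all_algebra.
From mathcomp Require Import all_classical all_reals all_analysis.

Set Implicit Arguments.
Unset Strict Implicit.
Unset Printing Implicit Defensive.

Import Order.TTheory GRing.Theory Num.Theory.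

Local Open Scope ring_scope.

Definition fact_poly (f : {poly int}) (n : nat) : int :=
  (n`!)%:Z + f.[n%:Z].

(* Junk value: [ordz p 0 = 0]; only nonzero [m] are meaningful. *)
Definition ordz (p : nat) (m : int) : nat := logn p `|m|%N.

(* The measure is finite, so [fine] is harmless, as soon as [J] is bounded. *)
Definition itv_length (R : realType) (J : interval R) : R :=
  fine (lebesgue_measure [set` J]).

(* All integers of [J] lie in [1, p), so counting over ['I_p] counts every [n]
   of [J] with [p %| n! + f(n)]. *)
Definition root_count_bound (R : realType) (f : {poly int}) (C0 : R) : Prop :=
  forall (p : nat) (J : interval R),
    prime p ->
    {subset J <= `[1, p%:R[} ->
    1 <= itv_length J ->
    #|[pred n : 'I_p | ((n : nat)%:R \in J) && (p%:Z %| fact_poly f n)%Z]|%:R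
      <= C0 * itv_length J `^ (2 / 3).

(* [g 1] is the unit of the iterated minimum because [nat] has no top element;
   for [1 <= k] the value is the minimum of [g 1, ..., g k]. *)
Definition min_upto (g : nat -> nat) (k : nat) : nat :=
  \big[minn/g 1%N]_(1 <= j < k.+1) g j.

(* Main.v *)
(* Sort the points [m_0 < ... < m_(t-1)]. Since [t' >= (1 + eps0) t / 2], at least
   [2 t' - t - 1] of the adjacent pairs [(m_i, m_(i+1))] lie among [n_1, ..., n_t'].
   If [H] lists the [t - 1] gaps in decreasing order and [s ~ eps0 t / 4], then
   [s + 1] of these pairs have a gap at most [G(t') = H_(2 t' - t - 1 - s)], and
   these values are every other entry of [H], so [\sum_t' G(t') <= |J| / 2].

   By pigeonhole, two such pairs [(a, a + h)] and [(b, b + k)] have nearly equal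
   gaps [h <= k]. If [p ^ e] divides [n! + f(n)] at the four points, eliminating
   the factorials shows that [p ^ e] divides
     [(b + k) ^_ k * f(b) * f(a + h) - (a + h) ^_ h * f(a) * f(b + k)].
   Both falling factorials are divisible by [h!], which is prime to [p]; if the
   difference is nonzero, then [x ^ h / h! <= t ^ h * exp (x / t)] yields
     [e log p <= h log t + x / t + (k - h + O(1)) log x],
   and summing over [t'] gives the theorem.

   The difference is nonzero when [h = k], by comparing the second difference of
   [log |f|] with the first difference of the falling factorial. When [h < k] and
   it vanishes, 2-adic orders force [k - h = O(log x)] and sizes force
   [h ^ 2 = O(x log x ^ 2)]. For [t] large compared with [log x ^ 2] the pigeonhole
   can be run with gaps that are either equal or too far apart for this; for smaller
   [t] the bound [e log p <= (h + O(1)) log x] from a single pair is enough. *)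

Require Import Defs.
From mathcomp Require Import all_boot all_order all_algebra.
From mathcomp Require Import all_classical all_reals all_analysis.
From mathcomp Require Import ring lra zify.

(** * Gaps between sorted points *)

Lemma sorted_ltn_nth_add (l : seq nat) (i k : nat) :
  sorted ltn l -> (i + k < size l)%N -> (nth 0 l i + k <= nth 0 l (i + k))%N.
Proof.
move=> sl; elim: k => [|k IHk] lt_ik; first by rewrite !addn0.
have {IHk} := IHk ltac:(lia).
have := @sorted_ltn_nth _ ltn ltn_trans 0%N l sl (i + k)%N (i + k.+1)%N.
rewrite !inE => /(_ ltac:(lia) ltac:(lia) ltac:(lia)); lia.
Qed.

(** If every stride of [k] positions advanced by more than [G %/ q], then [q] strides from the start
    would pass [G]. *)
Lemma sorted_close_pair (l : seq nat) (G k q : nat) :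
  sorted ltn l -> (0 < q)%N -> (k * q < size l)%N ->
  {in l, forall v, v <= G}%N ->
  exists2 i, (i + k < size l)%N & (nth 0 l (i + k) - nth 0 l i <= G %/ q)%N.
Proof.
move=> sl q_gt0 lt_kq leG.
have [/hasP[i _ /andP[]]|/hasPn none] :=
  boolP (has (fun i => (i + k < size l) && (nth 0 l (i + k) - nth 0 l i <= G %/ q))%N
             (iota 0 (size l))).
  by exists i.
have step r : (k * r < size l)%N -> ((G %/ q).+1 * r <= nth 0 l (k * r))%N.
  elim: r => [|r IHr] lt_r; first by rewrite muln0.
  have {IHr} := IHr ltac:(nia).
  have := none (k * r)%N; rewrite mem_iota => /(_ ltac:(nia)).
  have -> : (k * r + k = k * r.+1)%N by lia.
  rewrite lt_r /= -ltnNge; nia.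
have := leq_trans (ltn_ceil G q_gt0) (leq_trans (step q lt_kq) (leG _ (mem_nth 0%N lt_kq))).
by rewrite ltnn.
Qed.

(** Either two values of [h] coincide, or they sort to a strictly increasing list, whose entries [k]
    places apart differ by at least [k]. This lower bound is what later keeps unequal gaps far
    apart. *)
Lemma close_pair (h : nat -> nat) (A : seq nat) (G k q : nat) :
  uniq A -> (0 < k)%N -> (0 < q)%N -> (k * q < size A)%N ->
  {in A, forall i, h i <= G}%N ->
  exists i j, [/\ i \in A, j \in A, i != j &
    [/\ h i <= h j, h j - h i <= G %/ q & (h i == h j) || (k <= h j - h i)]%N].
Proof.
move=> uA k_gt0 q_gt0 lt_kq leG.
have [uh|/(uniqPn 0%N)[i [j [lt_ij]]]] := boolP (uniq (map h A)); last first.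
  rewrite size_map => lt_j; rewrite !(nth_map 0%N) ?(ltn_trans lt_ij) // => eq_h.
  have lt_i := ltn_trans lt_ij lt_j.
  exists (nth 0%N A i), (nth 0%N A j); rewrite !mem_nth // eq_h subnn eqxx leqnn.
  by rewrite nth_uniq // neq_ltn lt_ij; split.
set l := sort leq (map h A).
have sl : sorted ltn l.
  by rewrite ltn_sorted_uniq_leq sort_uniq uh sort_sorted //; apply: leq_total.
have szl : size l = size A by rewrite size_sort size_map.
have lP v : v \in l -> exists2 i, i \in A & v = h i.
  by rewrite mem_sort => /mapP.
have [||u lt_u le_u] := sorted_close_pair l G k q sl q_gt0.
- by rewrite szl.
- by move=> v /lP[i iA ->]; apply: leG.
have := @sorted_ltn_nth_add l u k sl lt_u.
have [i iA ei] : exists2 i, i \in A & nth 0 l u = h i.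
  by apply/lP/mem_nth; apply: leq_ltn_trans (leq_addr _ _) lt_u.
have [j jA ej] : exists2 j, j \in A & nth 0 l (u + k)%N = h j by apply/lP/mem_nth.
move: le_u; rewrite ei ej => le_u ge_u.
exists i, j; split => //; last by split => //; lia.
by apply: contraTneq ge_u => ->; lia.
Qed.

(** In decreasing order, the entries larger than the one at position [k] precede it; past the end,
    the size of the list is already at most [k]. *)
Lemma count_gt_nth_sort (l : seq nat) (k : nat) :
  (count (fun v => nth 0 (sort geq l) k < v) l <= k)%N.
Proof.
have tg : transitive geq by move=> a b c /= ab bc; apply: leq_trans bc ab.
have sl : sorted geq (sort geq l).
  by apply: sort_sorted => a b /=; apply: leq_total.
rewrite -(permP (permEl (perm_sort geq l))).
set L := sort geq l in sl *; clearbody L.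
rewrite -[X in count _ X](cat_take_drop k) count_cat.
rewrite [X in (_ + X)%N](_ : _ = 0)%N.
  by rewrite addn0 (leq_trans (count_size _ _)) // size_take; case: ifP => //; lia.
apply/eqP; rewrite -leqn0 leqNgt -has_count; apply/hasPn => v /(nthP 0%N)[i].
rewrite size_drop nth_drop => lt_i <-; rewrite -leqNgt.
have lt_ki : (k + i < size L)%N by rewrite -ltn_subRL.
by apply: (@sorted_leq_nth _ geq tg leqnn 0%N L sl k (k + i)%N);
   rewrite ?inE ?(leq_ltn_trans (leq_addr i k)) ?leq_addr.
Qed.

(** Each selected entry is at most its predecessor, so the two together pay for its double;
    [c < a.*2] ensures that a predecessor exists. *)
Lemma sum_alternate_nth (H : nat -> nat) (c a b : nat) :
  (forall i, H i.+1 <= H i)%N -> (c < a.*2)%N -> (a <= b)%N ->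
  (\sum_(a <= u < b) (H (u.*2 - c)).*2 <= \sum_(0 <= j < b.*2 - c.+1) H j)%N.
Proof.
move=> dH lt_ca; elim: b => [|b IHb] le_ab.
  by rewrite big_geq.
have [->|lt_ab] : a = b.+1 \/ (a <= b)%N by lia.
  by rewrite big_geq.
rewrite big_nat_recr //= (_ : b.+1.*2 - c.+1 = (b.*2 - c.+1).+2)%N; last by lia.
rewrite !big_nat_recr //=.
have := IHb lt_ab; have := dH (b.*2 - c.+1)%N.
rewrite (_ : (b.*2 - c.+1).+1 = b.*2 - c)%N; last by lia.
lia.
Qed.

(* Each entry of [m] missing from [S] spoils at most two adjacent pairs. *)
Lemma count_adjacent_present (m S : seq nat) :
  uniq m -> uniq S -> {subset S <= m} ->
  ((size S).*2 <= count (fun i => (nth 0 m i \in S) && (nth 0 m i.+1 \in S))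
                   (iota 0 (size m).-1) + (size m).+1)%N.
Proof.
move=> um uS subS.
have [e|m_gt0] : m = [::] \/ (0 < size m)%N by case: (m); [left | right].
  by have := uniq_leq_size uS subS; rewrite e /=; lia.
have cm : (count [in S] m = size S)%N.
  rewrite -size_filter; apply/perm_size/uniq_perm => //; first exact: filter_uniq.
  by move=> v; rewrite mem_filter; apply/andP/idP => [[]|vS] //; split=> //; apply: subS.
have cmiss : (count (predC [in S]) m + size S = size m)%N.
  by rewrite -cm addnC count_predC.
pose Q i := nth 0 m i \notin S.
have mE : (count Q (iota 0 (size m)) = count (predC [in S]) m)%N.
  by rewrite -[in RHS](mkseq_nth 0 m) count_map; apply: eq_count => i /=.
have e1 : (count Q (iota 0 (size m).-1) <= count (predC [in S]) m)%N.
  rewrite -mE -[in X in (_ <= X)%N](prednK m_gt0) -addn1 iotaD count_cat; lia.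
have e2 : (count (Q \o succn) (iota 0 (size m).-1) <= count (predC [in S]) m)%N.
  rewrite -mE -count_map -[in X in (_ <= X)%N](prednK m_gt0) /=.
  by rewrite -(iotaDl 1 0) -/(map _ _) leq_addl.
have := count_predC (fun i => (nth 0 m i \in S) && (nth 0 m i.+1 \in S)) (iota 0 (size m).-1).
have := count_predUI Q (Q \o succn) (iota 0 (size m).-1).
have -> : count (predU Q (Q \o succn)) (iota 0 (size m).-1) =
          count (predC (fun i => (nth 0 m i \in S) && (nth 0 m i.+1 \in S))) (iota 0 (size m).-1).
  by apply: eq_count => i /=; rewrite /Q negb_and.
rewrite size_iota; lia.
Qed.

Lemma sum_gaps (m : seq nat) (k : nat) :
  sorted ltn m -> (k < size m)%N ->
  (\sum_(0 <= i < k) (nth 0 m i.+1 - nth 0 m i) = nth 0 m k - nth 0 m 0)%N.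
Proof.
move=> sm lt_k; rewrite telescope_sumn_in // => i /andP[_ lt_ik].
have := @sorted_ltn_nth_add m i 1 sm; rewrite addn1; lia.
Qed.

(** The bound [G] is fixed before [k] and [q], so a single estimate of its sum serves every choice
    of the pigeonhole parameters. *)
Lemma close_gaps (n : nat -> nat) (t s T : nat) :
  (forall i j : nat, (1 <= i <= t)%N -> (1 <= j <= t)%N -> n i = n j -> i = j) ->
  (0 < t)%N -> (T <= t)%N -> (t + s + 3 <= T.*2)%N ->
  exists G : nat -> nat,
  (exists i j : nat, [/\ (1 <= i <= t)%N, (1 <= j <= t)%N, n i <= n j &
     \sum_(T <= u < t.+1) (G u).*2 <= n j - n i]%N) /\
  forall u k q : nat, (T <= u <= t)%N -> (0 < k)%N -> (0 < q)%N -> (k * q <= s)%N ->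
  exists a h b h' : nat,
  [/\ [/\ 0 < h, h <= h', h' <= G u, h' - h <= G u %/ q & (h == h') || (k <= h' - h)]%N,
      (a + h <= b)%N || (b + h' <= a)%N &
      forall y : nat, y \in [:: a; a + h; b; b + h']%N ->
        exists2 j : nat, (1 <= j <= u)%N & n j = y].
Proof.
move=> inj_n t_gt0 le_Tt le_sT.
pose pts u := [seq n i | i <- iota 1 u].
have upts u : (u <= t)%N -> uniq (pts u).
  move=> le_ut; rewrite map_inj_in_uniq ?iota_uniq // => i j.
  by rewrite !mem_iota => hi hj; apply: inj_n; lia.
have ptsP u y : y \in pts u -> exists2 j, (1 <= j <= u)%N & n j = y.
  by case/mapP => j; rewrite mem_iota => hj ->; exists j => //; lia.
pose m := sort leq (pts t).
have szm : size m = t by rewrite size_sort size_map size_iota.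
have sm : sorted ltn m.
  by rewrite ltn_sorted_uniq_leq sort_uniq upts // sort_sorted //; apply: leq_total.
have um : uniq m by rewrite sort_uniq upts.
have mP i : (i < t)%N -> exists2 j, (1 <= j <= t)%N & n j = nth 0 m i.
  by move=> lt_i; apply: ptsP; rewrite -(mem_sort leq) mem_nth // szm.
pose gap i := (nth 0 m i.+1 - nth 0 m i)%N.
have gapE i : (i < t.-1)%N -> nth 0 m i.+1 = (nth 0 m i + gap i)%N /\ (0 < gap i)%N.
  move=> lt_i; have := @sorted_ltn_nth_add m i 1 sm; rewrite addn1 szm /gap; lia.
pose hs := [seq gap i | i <- iota 0 t.-1].
pose H := nth 0%N (sort geq hs).
have dH i : (H i.+1 <= H i)%N.
  have tg : transitive geq by move=> a b c /= ab bc; apply: leq_trans bc ab.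
  have sH : sorted geq (sort geq hs).
    by apply: sort_sorted => a b /=; apply: leq_total.
  have [lt_i|ge_i] := ltnP i.+1 (size (sort geq hs)); last by rewrite /H nth_default.
  by apply: (@sorted_leq_nth _ geq tg leqnn 0%N _ sH i i.+1); rewrite ?inE //; lia.
(* At least [2u - t - 1] adjacent pairs are present and at most [2u - c] gaps exceed the entry of
   [H] at the zero-based position [2u - c], so [c - t - 1 = s + 1] present pairs have a small
   gap. *)
pose c := (t + s + 2)%N.
exists (fun u => H (u.*2 - c)%N); split.
  have [j hj ej] := mP t.-1 ltac:(lia).
  have [i hi ei] := mP 0%N ltac:(lia).
  exists i, j; split => //.
    have := @sorted_ltn_nth_add m 0 t.-1 sm; rewrite szm ei ej add0n; lia.
  rewrite ei ej -sum_gaps ?szm //; last by lia.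
  apply: leq_trans (_ : \sum_(0 <= j < t.-1) H j <= _)%N; last first.
    rewrite /index_iota subn0.
    rewrite -[X in (_ <= X)%N](big_map gap xpredT id) -/hs.
    rewrite -(perm_big _ (permEl (perm_sort geq hs))) /=.
    rewrite [X in (_ <= X)%N](big_nth 0%N) size_sort size_map size_iota.
    by rewrite /index_iota subn0.
  (* The alternating sum reaches only the first [2(t + 1) - (c + 1) = t - s - 1] entries of [H],
     among the [t - 1] gaps. *)
  apply: leq_trans (sum_alternate_nth H c T t.+1 dH ltac:(lia) ltac:(lia)) _.
  rewrite [X in (_ <= X)%N](@big_cat_nat _ _ _ (t.+1.*2 - c.+1)%N) ?leq_addr //=; lia.
move=> u k q /andP[le_Tu le_ut] k_gt0 q_gt0 le_kq.
pose pres i := (nth 0 m i \in pts u) && (nth 0 m i.+1 \in pts u).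
pose A := [seq i <- iota 0 t.-1 | pres i && (gap i <= H (u.*2 - c))%N].
have szA : (k * q < size A)%N.
  have := count_adjacent_present m (pts u) um (upts u le_ut).
  rewrite szm size_map size_iota => /(_ _)/wrap[].
    move=> y /mapP[i]; rewrite mem_iota => hi ->.
    by rewrite mem_sort map_f // mem_iota; lia.
  rewrite -/pres => le1.
  have := count_gt_nth_sort hs (u.*2 - c)%N; rewrite -/H /hs count_map => le2.
  rewrite size_filter.
  have := count_predC (fun i => gap i <= H (u.*2 - c))%N (iota 0 t.-1).
  have := count_predUI pres (fun i => gap i <= H (u.*2 - c))%N (iota 0 t.-1).
  have := count_size (predU pres (fun i => gap i <= H (u.*2 - c))%N) (iota 0 t.-1).
  have -> : count (predC (fun i => gap i <= H (u.*2 - c))%N) (iota 0 t.-1) =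
            count (preim gap (fun v => H (u.*2 - c) < v)%N) (iota 0 t.-1).
    by apply: eq_count => i /=; rewrite -ltnNge.
  rewrite /predI /= size_iota; move: le1 le2; rewrite /c.
  set c1 := count _ _; set c2 := count _ _; set c3 := count _ _.
  set c4 := count _ _; set c5 := count _ _.
  move: c1 c2 c3 c4 c5 => c1 c2 c3 c4 c5; lia.
have [] := close_pair gap A (H (u.*2 - c)%N) k q _ k_gt0 q_gt0 szA.
- by rewrite filter_uniq ?iota_uniq.
- by move=> i; rewrite mem_filter => /andP[/andP[]].
move=> i [j [+ + ne_ij [le_ij cl alt]]]; rewrite !mem_filter !mem_iota => /and3P[/andP[/andP[pi pi'] Gi] _ hi].
move=> /and3P[/andP[/andP[pj pj'] Gj] _ hj].
have [ei gi] := gapE i hi; have [ej gj] := gapE j hj.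
exists (nth 0 m i), (gap i), (nth 0 m j), (gap j); split.
- by split.
- have lem a b : (a < b)%N -> (b < t.-1)%N -> (nth 0 m a.+1 <= nth 0 m b)%N.
    move=> lt_ab lt_b; have := @sorted_ltn_nth_add m a.+1 (b - a.+1) sm.
    rewrite szm subnKC //; lia.
  move: ne_ij; rewrite neq_ltn -ei -ej => /orP[] lt_ij; apply/orP; [left|right]; apply: lem => //; lia.
- move=> y; rewrite -ei -ej !inE => /or4P[]/eqP->; exact: ptsP.
Qed.

(** * Falling factorials *)

(** Truncated Legendre sum for the prime 2: the quotients telescope under halving, and each halving
    loses at most one unit, whence the error [m]. *)
Lemma sum_divn_pow2 (n m : nat) :
  ((\sum_(1 <= k < m.+1) n %/ 2 ^ k) + n %/ 2 ^ m <= n)%N /\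
  (n <= (\sum_(1 <= k < m.+1) n %/ 2 ^ k) + n %/ 2 ^ m + m)%N.
Proof.
elim: m => [|m [IH1 IH2]]; first by rewrite big_geq // divn1; lia.
rewrite big_nat_recr //= expnSr divnMA.
by have := divn_eq (n %/ 2 ^ m) 2; have := ltn_mod (n %/ 2 ^ m) 2; lia.
Qed.

Lemma logn2_fact_le (n : nat) : (logn 2 n`! <= n)%N.
Proof. by rewrite logn_fact // (leq_trans (leq_addr _ _) (proj1 (sum_divn_pow2 n n))). Qed.

Lemma logn2_fact_ge (n L : nat) : (n < 2 ^ L)%N -> (n <= logn 2 n`! + L)%N.
Proof.
move=> lt_n; have [lt_nL|le_Ln] := ltnP n L; first by lia.
rewrite logn_fact // (@big_cat_nat _ _ _ L.+1) //=.
by have [_] := sum_divn_pow2 n L; rewrite divn_small //; lia.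
Qed.

Lemma fact_add (a h : nat) : ((a + h)`! = (a + h) ^_ h * a`!)%N.
Proof. by rewrite -(ffact_fact (leq_addl a h)) addnK. Qed.

Lemma ffact_add_split (a h d : nat) :
  ((a + h + d) ^_ (h + d) = (a + h + d) ^_ d * (a + h) ^_ h)%N.
Proof.
apply/eqP; rewrite -(eqn_pmul2r (fact_gt0 a)) -mulnA -!fact_add.
by rewrite -addnA -fact_add.
Qed.

Lemma ffact_le_expn (n m x : nat) : (n <= x)%N -> (n ^_ m <= x ^ m)%N.
Proof.
elim: m n => [|m IHm] n le_nx; first by rewrite ffactn0.
by rewrite ffactnS expnS leq_mul // IHm //; lia.
Qed.

Lemma leq_ffact2 (n n' m : nat) : (n <= n')%N -> (n ^_ m <= n' ^_ m)%N.
Proof.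
elim: m n n' => [|m IHm] n n' le_n; first by rewrite !ffactn0.
by rewrite !ffactnS leq_mul // IHm //; lia.
Qed.

Lemma ffact_ge_base (a h : nat) : (0 < h)%N -> (a <= (a + h) ^_ h)%N.
Proof.
case: h => // h _; rewrite addnS ffactSS.
have : (0 < (a + h) ^_ h)%N by rewrite ffact_gt0 leq_addl.
nia.
Qed.

(** Raising the base by [g] multiplies each of the [h] factors, all at most [x], by at least
    [1 + g/x]; Bernoulli's inequality keeps [1 + hg/x]. *)
Lemma ffact_shift_linear (a g h x : nat) : (a + h <= x)%N ->
  ((x + h * g) * (a + h) ^_ h <= x * (a + g + h) ^_ h)%N.
Proof.
elim: h => [|h IHh] le_x.
  by rewrite !ffactn0; lia.
have {}IHh := IHh ltac:(lia); rewrite !addnS !ffactSS.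
have := leq_mul (leqnn (a + g + h).+1) IHh.
have : ((x + h.+1 * g) * (a + h).+1 <= (a + g + h).+1 * (x + h * g))%N by nia.
set P := ((a + h) ^_ h)%N; set Q := ((a + g + h) ^_ h)%N.
move=> /(leq_mul (leqnn P)); lia.
Qed.

(** The same factorwise comparison, keeping the full power [(1 + g/x)^h]. *)
Lemma ffact_shift_geometric (b g h x : nat) : (b + h <= x)%N ->
  ((x + g) ^ h * (b + h) ^_ h <= x ^ h * (b + g + h) ^_ h)%N.
Proof.
elim: h => [|h IHh] le_x; first by rewrite !ffactn0.
have {}IHh := IHh ltac:(lia); rewrite !addnS !ffactSS !expnS.
rewrite mulnACA [leqRHS]mulnACA leq_mul //; nia.
Qed.

(** A quotient of two factorials, each with 2-adic order within [L] below its argument: the order of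
    a falling factorial thus reveals its length up to [L]. *)
Lemma logn2_ffact (a h L : nat) : (a + h < 2 ^ L)%N ->
  (logn 2 ((a + h) ^_ h) <= h + L /\ h <= logn 2 ((a + h) ^_ h) + L)%N.
Proof.
move=> lt_x.
have e : (logn 2 (a + h)`! = logn 2 ((a + h) ^_ h) + logn 2 a`!)%N.
  by rewrite fact_add lognM ?fact_gt0 // ffact_gt0 leq_addl.
have := logn2_fact_le a; have := logn2_fact_le (a + h).
have := logn2_fact_ge (a + h) L lt_x.
have := logn2_fact_ge a L (leq_ltn_trans (leq_addr h a) lt_x).
lia.
Qed.

Import Order.TTheory GRing.Theory Num.Theory.

Local Open Scope ring_scope.

(** * Growth of polynomials *)

(** Discrete derivative bounds: each difference gains a factor [x]. The proof is by induction on [d]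
    through [q = q1 * 'X + c], with powers of [x] on the left to avoid division. *)
Lemma poly_growth_bounds (R : realDomainType) (q : {poly R}) (d : nat) :
  (size q <= d.+1)%N ->
  exists2 B : R, 0 <= B & forall x a g h : R,
    1 <= x -> 0 <= a -> 0 <= g -> 0 <= h -> a + g + h <= x ->
    [/\ `|q.[a]| <= B * x ^+ d,
        x * `|q.[a + g] - q.[a]| <= B * g * x ^+ d &
        x ^+ 2 * `|q.[a + g + h] - q.[a + h] - (q.[a + g] - q.[a])|
          <= B * (g * h) * x ^+ d].
Proof.
elim: d q => [|d IHd] q sq.
  exists `|q`_0| => [|x a g h x1 a0 g0 h0 ax]; first exact: normr_ge0.
  have [c ->] : exists c, q = c%:P by exists q`_0; apply: size1_polyC.
  rewrite !hornerC !subrr normr0 !mulr0 coefC /= expr0 mulr1 lexx.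
  by split=> //; rewrite mulr1 ?mulr_ge0.
have [q1 [c eq]] : exists (q1 : {poly R}) (c : R), q = q1 * 'X + c%:P.
  by elim/poly_ind: q {sq} => [|q c _]; [exists 0, 0; rewrite mul0r addr0 | exists q, c].
rewrite {q}eq in sq *; rewrite size_MXaddC in sq.
have {}sq : (size q1 <= d.+1)%N.
  by move: sq; case: ifP => [/andP[/eqP->]|_ //]; rewrite size_poly0.
have [B B0 IH] := IHd q1 sq.
exists (3 * B + `|c|); first by rewrite addr_ge0 ?mulr_ge0.
move=> x a g h x1 a0 g0 h0 ax; rewrite !hornerMXaddC.
have [|||||vA dA ddA] := IH x a g h; try lra.
have [|||||vG _ _] := IH x (a + g) 0 0; try lra.
have [|||||_ dH _] := IH x (a + h) g 0; try lra.
have [|||||_ dG _] := IH x (a + g) h 0; try lra.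
rewrite (_ : a + h + g = a + g + h) in dH; last by ring.
have X1 : 1 <= x ^+ d by rewrite exprn_ege1.
rewrite exprS; move: (x ^+ d) X1 vA dA ddA vG dH dG => X X1.
move: q1.[a] q1.[a + g] q1.[a + h] q1.[a + g + h] => u ug uh ugh vA dA ddA vG dH dG.
have x0 : 0 <= x by lra.
have X0 : 0 <= X by lra.
have ax' : a <= x by lra.
have c0 := normr_ge0 c.
split.
- have : `|u * a + c| <= `|u| * a + `|c|.
    by rewrite (le_trans (ler_normD _ _)) // normrM (ger0_norm a0).
  have : `|u| * a <= (B * X) * x by rewrite ler_pM.
  have : `|c| <= `|c| * (x * X) by rewrite ler_peMr // mulr_ege1.
  have : 0 <= B * (x * X) by rewrite !mulr_ge0.
  nra.
- rewrite (_ : ug * (a + g) + c - _ = a * (ug - u) + g * ug); last by ring.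
  have : x * `|a * (ug - u) + g * ug| <= a * (x * `|ug - u|) + x * g * `|ug|.
    rewrite [leRHS](_ : _ = x * (a * `|ug - u| + g * `|ug|)); last by ring.
    by rewrite ler_wpM2l // (le_trans (ler_normD _ _)) // !normrM (ger0_norm a0) (ger0_norm g0).
  have : a * (x * `|ug - u|) <= x * (B * g * X) by rewrite ler_pM ?mulr_ge0.
  have : x * g * `|ug| <= x * g * (B * X) by rewrite ler_wpM2l // mulr_ge0.
  have : 0 <= B * g * (x * X) by rewrite !mulr_ge0.
  have : 0 <= `|c| * g * (x * X) by rewrite !mulr_ge0.
  lra.
(* Discrete Leibniz rule: one second difference and two first differences of [q1], which accounts
   for the [3 * B] in the constant. *)
rewrite (_ : _ - _ - _ = a * (ugh - uh - (ug - u)) + h * (ugh - uh) + g * (ugh - ug)); last by ring.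
have : x ^+ 2 * `|a * (ugh - uh - (ug - u)) + h * (ugh - uh) + g * (ugh - ug)|
   <= a * (x ^+ 2 * `|ugh - uh - (ug - u)|) + x * h * (x * `|ugh - uh|) + x * g * (x * `|ugh - ug|).
  rewrite [leRHS](_ : _ = x ^+ 2 * (a * `|ugh - uh - (ug - u)| + h * `|ugh - uh| + g * `|ugh - ug|));
    last by ring.
  rewrite ler_wpM2l ?exprn_ge0 // !(le_trans (ler_normD _ _)) // !normrM.
  rewrite (ger0_norm g0) lerD2r (le_trans (ler_normD _ _)) // !normrM.
  by rewrite (ger0_norm a0) (ger0_norm h0).
have : a * (x ^+ 2 * `|ugh - uh - (ug - u)|) <= x * (B * (g * h) * X).
  by rewrite ler_pM ?mulr_ge0 ?exprn_ge0.
have : x * h * (x * `|ugh - uh|) <= x * h * (B * g * X) by rewrite ler_wpM2l // mulr_ge0.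
have : x * g * (x * `|ugh - ug|) <= x * g * (B * h * X) by rewrite ler_wpM2l // mulr_ge0.
have : 0 <= `|c| * (g * h) * (x * X) by rewrite !mulr_ge0.
lra.
Qed.

(* [q(a+g) q(a+h) - q(a) q(a+g+h) = Dg q(a) Dh q(a) - q(a) Dg Dh q(a)] gains a
   factor [x^2] over the trivial bound. *)
Lemma poly_cross_difference (R : realDomainType) (q : {poly R}) (d : nat) :
  (size q <= d.+1)%N ->
  exists2 B : R, 0 <= B & forall x a g h : R,
    1 <= x -> 0 <= a -> 0 <= g -> 0 <= h -> a + g + h <= x ->
    x ^+ 2 * `|q.[a + g] * q.[a + h] - q.[a] * q.[a + g + h]|
      <= B * (g * h) * (x ^+ d) ^+ 2.
Proof.
move=> /poly_growth_bounds[B B0 IH].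
exists (2 * B ^+ 2) => [|x a g h x1 a0 g0 h0 ax]; first by rewrite mulr_ge0 ?exprn_ge0.
have [|||||vA dA ddA] := IH x a g h; try lra.
have [|||||_ dH _] := IH x a h 0; try lra.
have x0 : 0 <= x by lra.
have X0 : 0 <= x ^+ d by rewrite exprn_ge0.
move: (x ^+ d) X0 vA dA ddA dH => X X0.
move: q.[a] q.[a + g] q.[a + h] q.[a + g + h] => u ug uh ugh vA dA ddA dH.
rewrite (_ : _ - _ = (ug - u) * (uh - u) - u * (ugh - uh - (ug - u))); last by ring.
have : x ^+ 2 * `|(ug - u) * (uh - u) - u * (ugh - uh - (ug - u))| <=
  (x * `|ug - u|) * (x * `|uh - u|) + `|u| * (x ^+ 2 * `|ugh - uh - (ug - u)|).
  rewrite [leRHS](_ : _ = x ^+ 2 * (`|ug - u| * `|uh - u| + `|u| * `|ugh - uh - (ug - u)|));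
    last by ring.
  by rewrite ler_wpM2l ?exprn_ge0 // (le_trans (ler_normB _ _)) // !normrM.
have : (x * `|ug - u|) * (x * `|uh - u|) <= (B * g * X) * (B * h * X).
  by rewrite ler_pM ?mulr_ge0.
have : `|u| * (x ^+ 2 * `|ugh - uh - (ug - u)|) <= (B * X) * (B * (g * h) * X).
  by rewrite ler_pM ?mulr_ge0 ?exprn_ge0.
lra.
Qed.

Lemma poly_lower_growth (R : realFieldType) (q : {poly R}) :
  q != 0 -> 1 <= `|lead_coef q| ->
  exists2 X0 : R, 1 <= X0 & forall y : R, X0 <= y -> y ^+ (size q).-1 <= 2 * `|q.[y]|.
Proof.
move=> q0 lc1; case sq : (size q) => [|[|d]].
- by move/eqP: sq; rewrite size_poly_eq0 (negPf q0).
- exists 1 => // y _; move: lc1; rewrite /lead_coef sq expr0 => lc1.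
  by rewrite [q]size1_polyC ?sq // hornerC; lra.
pose r := q - lead_coef q *: 'X^(d.+1).
have sr : (size r <= d.+1)%N.
  apply/leq_sizeP => j; rewrite /r coefB coefZ coefXn lead_coefE sq /=.
  rewrite leq_eqVlt => /predU1P[<-|lt_j]; first by rewrite eqxx mulr1 subrr.
  rewrite gtn_eqF // mulr0 subr0 nth_default // sq //.
have [B B0 bnd] := poly_growth_bounds _ _ _ sr.
(* For [y >= 2 * B] the remainder [r], at most [B * y ^+ d], is at most half of [y ^+ d.+1]. *)
exists (1 + 2 * B) => [|y y_ge]; first by lra.
have [|||||vA _ _] := bnd y y 0 0; try lra.
have -> : q.[y] = lead_coef q * y ^+ d.+1 + r.[y].
  by rewrite /r hornerD hornerN hornerZ hornerXn addrC subrK.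
have Y0 : 0 <= y ^+ d by rewrite exprn_ge0 //; lra.
have : `|lead_coef q * y ^+ d.+1| <= `|lead_coef q * y ^+ d.+1 + r.[y]| + `|r.[y]|.
  by rewrite -[X in `|X| <= _](addrK r.[y]) (le_trans (ler_normB _ _)).
rewrite normrM [y ^+ _.+1]exprS normrM (ger0_norm Y0) (ger0_norm (_ : 0 <= y)); last lra.
move: (y ^+ d) Y0 vA => Y Y0 vA.
have yY : 0 <= y * Y by rewrite mulr_ge0 //; lra.
have : y * Y <= `|lead_coef q| * (y * Y) by rewrite ler_peMl.
have : 2 * B * Y <= y * Y by rewrite ler_wpM2r //; lra.
lra.
Qed.

(** * Divisibility by prime powers *)

Lemma prime_coprime_fact (p n : nat) : prime p -> (n < p)%N -> coprime p n`!.
Proof.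
move=> p_pr; elim: n => [|n IHn] lt_np; first by rewrite coprimen1.
rewrite factS coprimeMr IHn ?(ltnW lt_np) // andbT prime_coprime //.
by apply/negP => /dvdn_leq => /(_ isT); rewrite leqNgt lt_np.
Qed.

Lemma dvd_fact_ffact (h k m : nat) : (h <= k)%N -> (h`! %| m ^_ k)%N.
Proof.
move=> le_hk; rewrite -bin_ffact dvdn_mull //.
by rewrite -(ffact_fact (leq_subr h k)) subKn // dvdn_mull.
Qed.

(** Cross product of the two congruences that [dvd_step] gives for the pairs [(a, a + h)] and
    [(b, b + k)]: the left side of each is multiplied by the right side of the other. *)
Definition cross_diff (f : {poly int}) (a h b k : nat) : int :=
  ((b + k) ^_ k)%:Z * (f.[b%:Z] * f.[(a + h)%:Z]) -
  ((a + h) ^_ h)%:Z * (f.[a%:Z] * f.[(b + k)%:Z]).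

(** Modulo [m], [a!] is [-f(a)] and [(a + h)!] is [-f(a + h)], while their quotient is the falling
    factorial. *)
Lemma dvd_step (f : {poly int}) (m : int) (a h : nat) :
  (m %| fact_poly f a)%Z -> (m %| fact_poly f (a + h))%Z ->
  (m %| ((a + h) ^_ h)%:Z * f.[a%:Z] - f.[(a + h)%:Z])%Z.
Proof.
rewrite /fact_poly fact_add PoszM => da dah.
rewrite (_ : _ - _ = ((a + h) ^_ h)%:Z * ((a`!)%:Z + f.[a%:Z]) -
   (((a + h) ^_ h)%:Z * (a`!)%:Z + f.[(a + h)%:Z])); last by ring.
by rewrite rpredB // dvdz_mull.
Qed.

(* The factorial [h!] divides both terms and is prime to [p]: this is the
   saving over the trivial bound [p ^ e <= |cross_diff|]. *)
Lemma cross_diff_ge (f : {poly int}) (p e a h b k : nat) :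
  prime p -> (h <= k)%N -> (h < p)%N ->
  (forall y : nat, y \in [:: a; a + h; b; b + k]%N -> ((p ^ e)%:Z %| fact_poly f y)%Z) ->
  cross_diff f a h b k != 0 ->
  (p ^ e * h`! <= `|cross_diff f a h b k|)%N.
Proof.
move=> p_pr le_hk lt_hp dvd nz.
rewrite dvdn_leq ?absz_gt0 // Gauss_dvd; last first.
  by rewrite coprimeXl // prime_coprime_fact.
apply/andP; split; last first.
  suff : ((h`!)%:Z %| cross_diff f a h b k)%Z by rewrite dvdzE.
  by rewrite /cross_diff rpredB // dvdz_mulr // dvdzE /= dvd_fact_ffact.
have da : ((p ^ e)%:Z %| ((a + h) ^_ h)%:Z * f.[a%:Z] - f.[(a + h)%:Z])%Z.
  by apply: dvd_step; apply: dvd; rewrite !inE eqxx ?orbT.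
have db : ((p ^ e)%:Z %| ((b + k) ^_ k)%:Z * f.[b%:Z] - f.[(b + k)%:Z])%Z.
  by apply: dvd_step; apply: dvd; rewrite !inE eqxx ?orbT.
suff : ((p ^ e)%:Z %| cross_diff f a h b k)%Z by rewrite dvdzE.
rewrite (_ : cross_diff f a h b k =
   (((b + k) ^_ k)%:Z * f.[b%:Z] - f.[(b + k)%:Z]) * f.[(a + h)%:Z] -
   f.[(b + k)%:Z] * (((a + h) ^_ h)%:Z * f.[a%:Z] - f.[(a + h)%:Z])); last first.
  by rewrite /cross_diff; ring.
by apply: rpredB; [apply: dvdz_mulr | apply: dvdz_mull].
Qed.

(** Compare 2-adic orders on both sides of the vanishing equation: the falling factorials contribute
    [k] and [h] up to logarithmic errors, and the power of 2 in the values of [f] is at most their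
    size. *)
Lemma expn2_sub_le_of_cross_diff_eq0 (f : {poly int}) (a h b k x : nat) :
  cross_diff f a h b k = 0 -> f.[b%:Z] * f.[(a + h)%:Z] != 0 ->
  f.[a%:Z] * f.[(b + k)%:Z] != 0 ->
  (0 < x)%N -> (a + h <= x)%N -> (b + k <= x)%N ->
  (2 ^ (k - h) <= (2 * x) ^ 2 * `|(f.[a%:Z] * f.[(b + k)%:Z])%R|)%N.
Proof.
rewrite /cross_diff; set U := f.[b] * _; set V := f.[a] * _; clearbody U V.
move=> /eqP; rewrite subr_eq0 => /eqP/(congr1 absz); rewrite !abszM !absz_nat.
move=> eqN U0 V0 x_gt0 le_a le_b.
have Pb : (0 < (b + k) ^_ k)%N by rewrite ffact_gt0 leq_addl.
have Pa : (0 < (a + h) ^_ h)%N by rewrite ffact_gt0 leq_addl.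
rewrite -absz_gt0 in U0; rewrite -absz_gt0 in V0.
(* The binary length of [x], so that [x < 2 ^ L <= 2 * x]. *)
pose L := (trunc_log 2 x).+1.
have ltx : (x < 2 ^ L)%N by rewrite trunc_log_ltn.
have leL : (2 ^ L <= 2 * x)%N by rewrite expnS leq_mul // trunc_logP.
have := congr1 (logn 2) eqN; rewrite !lognM // => eqv.
have [va _] := logn2_ffact a h L (leq_ltn_trans le_a ltx).
have [_ vb] := logn2_ffact b k L (leq_ltn_trans le_b ltx).
apply: leq_trans (_ : 2 ^ (L * 2) * 2 ^ logn 2 `|V| <= _)%N.
  by rewrite -expnD leq_pexp2l //; lia.
rewrite expnM leq_mul ?leq_exp2r //.
by rewrite dvdn_leq // pfactor_dvdnn.
Qed.

(** * Nonvanishing of the difference *)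

(** [y^n / n!] is one term of the exponential series. With [y = x/t] this becomes the lower bound
    for [h!] behind [two_gap_bound]. *)
Lemma expr_le_fact_expR (R : realType) (y : R) (n : nat) :
  0 <= y -> y ^+ n <= n`!%:R * expR y.
Proof.
case: n => [|n] y0; first by rewrite expr0 mul1r -expR0 ler_expR.
rewrite mulrC -ler_pdivrMr ?ltr0n ?fact_gt0 //.
by have := expR_ge1Dxn n y0; lra.
Qed.

(** Collects what the later size estimates need from [f]: values of exact order [x^d] on
    [[eps * x, x]], and a cross difference smaller than trivial by [x^2]. The constants are to be
    uniform in [x]. *)
Definition growth_at (R : realType) (f : {poly int}) (eps c B : R) (d x : nat) : Prop :=
  (forall a : nat, eps * x%:R <= a%:R -> (a <= x)%N ->
     c * x%:R ^+ d <= `|(f.[a%:Z])%:~R| <= B * x%:R ^+ d) /\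
  (forall a g h : nat, (a + g + h <= x)%N ->
     x%:R ^+ 2 * `|(f.[(a + g)%:Z] * f.[(a + h)%:Z] - f.[a%:Z] * f.[(a + g + h)%:Z])%:~R|
       <= B * (g%:R * h%:R) * (x%:R ^+ d) ^+ 2).

Lemma poly_growth (R : realType) (f : {poly int}) (eps : R) :
  f != 0 -> 0 < eps -> eps <= 1 ->
  exists (d : nat) (c B X0 : R), [/\ 0 < c, 0 <= B, 1 <= X0 &
    forall x : nat, X0 <= x%:R -> growth_at R f eps c B d x].
Proof.
move=> f0 eps0 eps1.
pose q : {poly R} := map_poly intr f.
have qE (a : nat) : (f.[a%:Z])%:~R = q.[a%:R] by rewrite -[a%:R]/(a%:Z%:~R) horner_map.
have sq : size q = size f by apply: size_map_inj_poly => //; apply: intr_inj.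
have q0 : q != 0 by rewrite -size_poly_eq0 sq size_poly_eq0.
have lq : 1 <= `|lead_coef q|.
  rewrite lead_coef_map_inj //; last exact: intr_inj.
  by rewrite -intr_norm -[1]/(1%:~R) ler_int -gtz0_ge1 normr_gt0 lead_coef_eq0.
have [X1 X1_ge lowq] := poly_lower_growth R q q0 lq.
have sqd : (size q <= (size q).-1.+1)%N by exact: leqSpred.
have [B1 B1_ge bnd] := poly_growth_bounds R q _ sqd.
have [B2 B2_ge crs] := poly_cross_difference R q _ sqd.
move: (size q).-1 lowq bnd crs => d lowq bnd crs.
(* The lower bound [y ^+ d / 2] is applied at points [y >= eps * x], and [x >= X1 / eps] puts these
   beyond the threshold [X1]. *)
exists d, (eps ^+ d / 2), (B1 + B2), (X1 / eps); split.
- by rewrite divr_gt0 ?exprn_gt0.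
- by rewrite addr_ge0.
- by rewrite ler_pdivlMr // mul1r; lra.
move=> x; rewrite ler_pdivrMr // => x_ge.
have x1 : 1 <= x%:R :> R by nra.
have Xd : 0 <= (x%:R : R) ^+ d by rewrite exprn_ge0 //; lra.
split=> [a a_ge a_le|a g h le_x].
  rewrite qE; apply/andP; split.
    have := lowq a%:R ltac:(lra).
    have : (eps * x%:R) ^+ d <= a%:R ^+ d by rewrite lerXn2r // nnegrE; nra.
    by rewrite exprMn; lra.
  have [|||||vA _ _] := bnd x%:R a%:R 0 0; rewrite ?ler0n ?addr0 ?ler_nat //.
  by nra.
rewrite intrB !intrM !qE !natrD.
have := crs x%:R a%:R g%:R h%:R x1 (ler0n _ _) (ler0n _ _) (ler0n _ _).
rewrite -!natrD ler_nat => /(_ le_x) /le_trans -> //.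
by rewrite !ler_wpM2r ?exprn_ge0 ?mulr_ge0 //; lra.
Qed.

Lemma cross_diff_eq0 (R : realType) (f : {poly int}) (a h b k : nat) :
  cross_diff f a h b k = 0 ->
  ((b + k) ^_ k)%:R * ((f.[b%:Z] * f.[(a + h)%:Z])%:~R : R) =
  ((a + h) ^_ h)%:R * ((f.[a%:Z] * f.[(b + k)%:Z])%:~R : R).
Proof.
move=> /eqP; rewrite subr_eq0 => /eqP/(congr1 (fun z : int => z%:~R : R)).
by rewrite [LHS]intrM [RHS]intrM !pmulrn.
Qed.

Lemma growth_at_prod (R : realType) (f : {poly int}) (eps c B : R) (d x y z : nat) :
  growth_at R f eps c B d x -> 0 < c -> eps * x%:R <= y%:R -> eps * x%:R <= z%:R ->
  (y <= x)%N -> (z <= x)%N ->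
  c ^+ 2 * (x%:R ^+ d) ^+ 2 <= `|(f.[y%:Z] * f.[z%:Z])%:~R| <= B ^+ 2 * (x%:R ^+ d) ^+ 2.
Proof.
move=> [sz _] c0 y_ge z_ge le_yx le_zx.
have /andP[y1 y2] := sz y y_ge le_yx; have /andP[z1 z2] := sz z z_ge le_zx.
have cX : 0 <= c * x%:R ^+ d by rewrite mulr_ge0 ?exprn_ge0 // ltW.
by rewrite intrM normrM -!exprMn !expr2 !ler_pM.
Qed.

Lemma growth_at_prod_ge (R : realType) (f : {poly int}) (eps c B : R) (d x a y z : nat) :
  growth_at R f eps c B d x -> 0 < c -> eps * x%:R <= a%:R ->
  (a <= y <= x)%N -> (a <= z <= x)%N ->
  c ^+ 2 * (x%:R ^+ d) ^+ 2 <= `|(f.[y%:Z] * f.[z%:Z])%:~R| <= B ^+ 2 * (x%:R ^+ d) ^+ 2.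
Proof.
move=> gr c0 a_ge /andP[le_ay le_yx] /andP[le_az le_zx].
by apply: growth_at_prod gr c0 _ _ le_yx le_zx; rewrite (le_trans a_ge) ?ler_nat.
Qed.

(** If it vanished, the ratio of the falling factorials would equal a ratio of values of [f]. The
    former exceeds 1 by at least [gh/x], the latter differs from 1 by only [O(gh/x^2)]. *)
Lemma cross_diff_neq0_same_gap (R : realType) (f : {poly int}) (eps c B : R)
    (d x a g h : nat) :
  growth_at R f eps c B d x -> 0 < c -> 1 <= x%:R :> R -> B < c ^+ 2 * x%:R ->
  eps * x%:R <= a%:R -> (0 < g)%N -> (0 < h)%N -> (a + g + h <= x)%N ->
  cross_diff f a h (a + g) h != 0.
Proof.
move=> gr c0 x1 x_gt a_ge g0 h0 le_x; apply/eqP => /(cross_diff_eq0 R).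
have g0R : 0 <= (g%:R : R) by rewrite ler0n.
have h0R : 0 <= (h%:R : R) by rewrite ler0n.
have /andP[leU _] := growth_at_prod_ge R f eps c B d x a (a + g) (a + h)%N gr c0 a_ge ltac:(lia) ltac:(lia).
have := gr.2 a g h le_x.
have : (x%:R + h%:R * g%:R) * ((a + h) ^_ h)%:R <= x%:R * ((a + g + h) ^_ h)%:R :> R.
  by rewrite -natrM -natrD -!natrM ler_nat; apply: ffact_shift_linear; lia.
have Pa : 0 < ((a + h) ^_ h)%:R :> R by rewrite ltr0n ffact_gt0 leq_addl.
rewrite intrB; move: leU; set U := (_ * _)%:~R; set V := (_ * _)%:~R => leU lin crs eqN.
have X0 : 0 < (x%:R : R) ^+ d by rewrite exprn_gt0 //; lra.
have gh0 : 0 < (g%:R * h%:R : R) by rewrite mulr_gt0 ?ltr0n.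
move: ((a + h) ^_ h)%:R ((a + g + h) ^_ h)%:R Pa lin eqN => Pa Pb Pa0 lin eqN.
have e1 : (Pb - Pa) * `|U| = Pa * `|U - V|.
  have Pab : 0 <= Pb - Pa by nra.
  rewrite -[X in X * `|U|](ger0_norm Pab) -[X in X * `|U - _|](ger0_norm (ltW Pa0)).
  by rewrite -!normrM mulrBl mulrBr eqN -normrN; congr `|_|; ring.
have e2 : (g%:R * h%:R) * `|U| <= x%:R * `|U - V|.
  rewrite -(ler_pM2l Pa0) [leRHS]mulrCA -e1 [leRHS]mulrA mulrA ler_wpM2r //; lra.
have e3 : x%:R * `|U| <= B * (x%:R ^+ d) ^+ 2.
  rewrite -(ler_pM2l gh0).
  have : x%:R * (g%:R * h%:R * `|U|) <= x%:R * (x%:R * `|U - V|) by rewrite ler_wpM2l //; lra.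
  by lra.
have : x%:R * (c ^+ 2 * (x%:R ^+ d) ^+ 2) <= B * (x%:R ^+ d) ^+ 2.
  by apply: le_trans e3; rewrite ler_wpM2l //; lra.
have Y0 : 0 < ((x%:R : R) ^+ d) ^+ 2 by rewrite exprn_gt0.
rewrite mulrA (ler_pM2r Y0) => le_xB.
by have := le_lt_trans le_xB x_gt; rewrite mulrC ltxx.
Qed.

Lemma ln_natr_ge0 (R : realType) (n : nat) : 0 <= ln n%:R :> R.
Proof. by case: n => [|n]; [rewrite ln0 | rewrite ln_ge0 // ler1n]. Qed.

Lemma half_le_ln2 (R : realType) : 1 / 2 <= ln 2 :> R.
Proof.
have := @le_ln1Dx R (- (1 / 2)) ltac:(lra).
by rewrite (_ : 1 + - (1 / 2) = 2^-1) ?lnV ?posrE //; lra.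
Qed.

Lemma half_le_ln1D (R : realType) (u : R) : 0 <= u -> u <= 1 -> u / 2 <= ln (1 + u).
Proof.
move=> u0 u1; have u10 : 0 < 1 + u by lra.
have : -1 < - (u / (1 + u)) by rewrite ltrN2 ltr_pdivrMr //; lra.
move=> /le_ln1Dx; rewrite (_ : 1 + - (u / (1 + u)) = (1 + u)^-1); last by field; lra.
rewrite lnV ?posrE // lerN2; apply: le_trans.
by rewrite ler_wpM2l // lef_pV2 ?posrE //; lra.
Qed.

(** The longer falling factorial at the later point is larger by a factor at least [eps * x], which
    bounded ratios of values of [f] cannot offset. Hence vanishing with [h < k] forces [b < a]. *)
Lemma cross_diff_eq0_gap_order (R : realType) (f : {poly int}) (eps c B : R)
    (d x a h b k : nat) :
  growth_at R f eps c B d x -> 0 < c -> 0 < eps -> 1 <= x%:R :> R ->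
  B ^+ 2 < c ^+ 2 * (eps * x%:R) ->
  eps * x%:R <= a%:R -> (a <= b)%N -> (h < k)%N -> (b + k <= x)%N ->
  cross_diff f a h b k != 0.
Proof.
move=> gr c0 eps0 x1 x_gt a_ge le_ab lt_hk le_x; apply/eqP => /(cross_diff_eq0 R).
have h0R : 0 <= (h%:R : R) by rewrite ler0n.
have k0R : 0 <= (k%:R : R) by rewrite ler0n.
have b_ge : eps * x%:R <= b%:R by apply: le_trans a_ge _; rewrite ler_nat.
have rb : (a <= b <= x)%N by clear -le_ab le_x; lia.
have rah : (a <= a + h <= x)%N by clear -le_ab lt_hk le_x; lia.
have ra : (a <= a <= x)%N by clear -le_ab le_x; lia.
have rbk : (a <= b + k <= x)%N by clear -le_ab le_x; lia.
have /andP[leU _] := growth_at_prod_ge R f eps c B d x a b (a + h)%N gr c0 a_ge rb rah.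
have /andP[_ geV] := growth_at_prod_ge R f eps c B d x a a (b + k)%N gr c0 a_ge ra rbk.
have X0 : 0 < (x%:R : R) ^+ d by rewrite exprn_gt0 //; lra.
move: leU geV; set U := (_ * _)%:~R; set V := (_ * _)%:~R => leU geV eqN.
have Pa : 0 < ((a + h) ^_ h)%:R :> R by rewrite ltr0n ffact_gt0 leq_addl.
have lePb : (eps * x%:R) * ((a + h) ^_ h)%:R <= ((b + k) ^_ k)%:R :> R.
  apply: le_trans (_ : (a * (a + h) ^_ h)%:R <= _); first by rewrite natrM ler_pM2r.
  (* The intermediate term is [(a + k) ^_ k]: first lengthen the product from [h] to [k] factors,
     then move its base from [a] to [b]. *)
  rewrite ler_nat; apply: leq_trans (_ : (a + h + (k - h)) ^_ (h + (k - h)) <= _)%N.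
    rewrite ffact_add_split leq_mul2r; apply/orP; right.
    by apply: leq_trans (ffact_ge_base _ _ _); rewrite ?leq_addr ?subn_gt0.
  have e : (h + (k - h) = k)%N by rewrite subnKC // ltnW.
  by rewrite -addnA !e leq_ffact2 // leq_add2r.
move: ((a + h) ^_ h)%:R ((b + k) ^_ k)%:R Pa lePb eqN => Pa Pb Pa0 lePb eqN.
have ex0 : 0 < eps * x%:R by rewrite mulr_gt0 //; lra.
have Pb0 : 0 < Pb by apply: lt_le_trans lePb; rewrite mulr_gt0.
have : Pb * `|U| = Pa * `|V|.
  by rewrite -[X in X * `|U|](gtr0_norm Pb0) -[X in X * `|V|](gtr0_norm Pa0) -!normrM eqN.
have : (eps * x%:R) * Pa * (c ^+ 2 * (x%:R ^+ d) ^+ 2) <= Pb * `|U|.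
  by rewrite ler_pM // ?mulr_ge0 ?exprn_ge0 // ltW.
have : Pa * `|V| <= Pa * (B ^+ 2 * (x%:R ^+ d) ^+ 2) by rewrite ler_pM2l.
have : B ^+ 2 * (Pa * (x%:R ^+ d) ^+ 2) < c ^+ 2 * (eps * x%:R) * (Pa * (x%:R ^+ d) ^+ 2).
  by rewrite ltr_pM2r // mulr_gt0 // exprn_gt0.
by lra.
Qed.

(** Moving the base from [b] up to [a], by at least [h], multiplies a product of length [h] by at
    least [(1 + h/x)^h], about [exp(h^2/x)]. The [k - h] extra factors at [b] offset at most
    [x^(k - h)], and the values of [f] at most one more [x]. *)
Lemma cross_diff_eq0_sqr_gap (R : realType) (f : {poly int}) (eps c B : R)
    (d x a h b k : nat) :
  growth_at R f eps c B d x -> 0 < c -> 1 <= x%:R :> R -> B ^+ 2 <= c ^+ 2 * x%:R ->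
  eps * x%:R <= b%:R -> (0 < h)%N -> (h <= k)%N -> (b + k <= a)%N -> (a + h <= x)%N ->
  cross_diff f a h b k = 0 ->
  (h%:R : R) ^+ 2 <= 2 * x%:R * ((k - h)%:R + 1) * ln x%:R.
Proof.
move=> gr c0 x1 x_ge b_ge h_gt0 le_hk le_ba le_x /(cross_diff_eq0 R).
have rb : (b <= b <= x)%N by clear -le_ba le_x; lia.
have rah : (b <= a + h <= x)%N by clear -le_ba le_x; lia.
have ra : (b <= a <= x)%N by clear -le_ba le_x; lia.
have rbk : (b <= b + k <= x)%N by clear -le_ba le_x; lia.
have rbh : (b + h <= x)%N by clear -le_ba le_x le_hk; lia.
have le_hg : (h <= a - b)%N by clear -le_ba le_hk; lia.
have /andP[_ geU] := growth_at_prod_ge R f eps c B d x b b (a + h)%N gr c0 b_ge rb rah.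
have /andP[leV _] := growth_at_prod_ge R f eps c B d x b a (b + k)%N gr c0 b_ge ra rbk.
have X0 : 0 < (x%:R : R) ^+ d by rewrite exprn_gt0 //; lra.
move: geU leV; set U := (_ * _)%:~R; set V := (_ * _)%:~R => geU leV eqN.
have leP : ((b + k) ^_ k)%:R <= x%:R ^+ (k - h) * ((b + h) ^_ h)%:R :> R.
  rewrite -natrX -natrM ler_nat -{1 2}(subnKC le_hk) addnA ffact_add_split.
  by rewrite leq_mul2r ffact_le_expn ?orbT // -addnA subnKC //; case/andP: rbk.
have geo : (x%:R + (a - b)%:R) ^+ h * ((b + h) ^_ h)%:R <= x%:R ^+ h * ((a + h) ^_ h)%:R :> R.
  rewrite -natrD -!natrX -!natrM ler_nat -{2}(subnKC (_ : b <= a)%N); last by case/andP: ra.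
  exact: ffact_shift_geometric.
have Q0 : 0 < ((b + h) ^_ h)%:R :> R by rewrite ltr0n ffact_gt0 leq_addl.
have Pb0 : 0 < ((b + k) ^_ k)%:R :> R by rewrite ltr0n ffact_gt0 leq_addl.
have Pa0 : 0 < ((a + h) ^_ h)%:R :> R by rewrite ltr0n ffact_gt0 leq_addl.
move: ((a + h) ^_ h)%:R ((b + k) ^_ k)%:R ((b + h) ^_ h)%:R Q0 Pb0 Pa0 leP geo eqN
  => Pa Pb Q Q0 Pb0 Pa0 leP geo eqN.
have x0 : 0 < x%:R :> R by lra.
have eqa : Pb * `|U| = Pa * `|V|.
  by rewrite -[X in X * `|U|](gtr0_norm Pb0) -[X in X * `|V|](gtr0_norm Pa0) -!normrM eqN.
have Y0 : 0 < ((x%:R : R) ^+ d) ^+ 2 by rewrite exprn_gt0.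
move: (((x%:R : R) ^+ d) ^+ 2) Y0 geU leV => Y Y0 geU leV {X0}.
have lePa : Pa <= x%:R * Pb.
  have c2 : 0 < c ^+ 2 by rewrite exprn_gt0.
  rewrite -(ler_pM2l (mulr_gt0 c2 Y0)).
  have : Pa * (c ^+ 2 * Y) <= Pa * `|V| by rewrite ler_pM2l.
  have : Pb * `|U| <= Pb * (B ^+ 2 * Y) by rewrite ler_pM2l.
  have : B ^+ 2 * (Pb * Y) <= c ^+ 2 * x%:R * (Pb * Y) by rewrite ler_wpM2r // mulr_ge0 // ltW.
  by clear -eqa; lra.
have : (x%:R + (a - b)%:R) ^+ h <= x%:R ^+ (h + (k - h).+1) :> R.
  rewrite -(ler_pM2r Q0) (le_trans geo) // exprD -mulrA ler_wpM2l ?exprn_ge0 ?(ltW x0) //.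
  by rewrite (le_trans lePa) // exprS -mulrA ler_wpM2l // ltW.
have xg0 : 0 < x%:R + (a - b)%:R :> R by rewrite ltr_pwDl.
rewrite -ler_ln ?posrE ?exprn_gt0 // !lnXn //.
have hx : h%:R <= x%:R :> R.
  by rewrite ler_nat; clear -rbh; lia.
have hx1 : h%:R / x%:R <= 1 :> R by rewrite ler_pdivrMr // mul1r.
have hx0 : 0 <= h%:R / x%:R :> R by rewrite divr_ge0 // ltW.
have u0 : 0 < 1 + h%:R / x%:R :> R by rewrite ltr_pwDl.
have lnge : ln x%:R + h%:R / x%:R / 2 <= ln (x%:R + (a - b)%:R) :> R.
  apply: le_trans (_ : ln (x%:R * (1 + h%:R / x%:R)) <= _).
    by rewrite lnM ?posrE // lerD2l half_le_ln1D.
  rewrite ler_ln ?posrE ?mulr_gt0 // mulrDr mulr1 mulrCA divff ?gt_eqF // mulr1.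
  by rewrite lerD2l ler_nat.
rewrite -[ln _ *+ h]mulr_natl -[_ *+ (_ + _)]mulr_natl natrD -natr1 => le_ln.
have le2 : h%:R * (ln x%:R + h%:R / x%:R / 2) <= h%:R * ln (x%:R + (a - b)%:R) :> R.
  by rewrite ler_wpM2l.
have {}le2 : h%:R * (h%:R / x%:R / 2) <= ((k - h)%:R + 1) * ln x%:R :> R by clear -le2 le_ln; lra.
rewrite -[leRHS]mulrA.
have x20 : 0 < 2 * x%:R :> R by rewrite mulr_gt0.
have := le2; rewrite -(ler_pM2l x20) => /(le_trans _) -> //.
  by rewrite le_eqVlt; apply/orP; left; apply/eqP; field; rewrite gt_eqF.
Qed.


Lemma cross_diff_eq0_gap_le_ln (R : realType) (f : {poly int}) (eps c B : R)
    (d x a h b k : nat) :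
  growth_at R f eps c B d x -> 0 < c -> 1 <= x%:R :> R -> 4 * B ^+ 2 <= x%:R ->
  eps * x%:R <= a%:R -> eps * x%:R <= b%:R -> (a + h <= x)%N -> (b + k <= x)%N ->
  cross_diff f a h b k = 0 ->
  (k - h)%:R <= (2 * (2 * d + 3))%:R * ln x%:R :> R.
Proof.
move=> gr c0 x1 x_ge a_ge b_ge le_a le_b eq0.
have shift y i : eps * x%:R <= y%:R -> eps * x%:R <= (y + i)%:R.
  by move=> /le_trans -> //; rewrite ler_nat leq_addr.
have x0 : 0 < x%:R :> R by apply: lt_le_trans x1.
have x_gt0 : (0 < x)%N by rewrite -(ltr0n R).
have nz z : c ^+ 2 * (x%:R ^+ d) ^+ 2 <= `|z%:~R : R| -> z != 0.
  apply: contraTneq => ->; rewrite normr0 -ltNge.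
  by rewrite mulr_gt0 ?exprn_gt0.
have /andP[/nz U0 _] := growth_at_prod R f eps c B d x b (a + h)%N gr c0 b_ge (shift a h a_ge) (leq_trans (leq_addr _ _) le_b) le_a.
have /andP[/nz V0 leV] := growth_at_prod R f eps c B d x a (b + k)%N gr c0 a_ge (shift b k b_ge) (leq_trans (leq_addr _ _) le_a) le_b.
have := expn2_sub_le_of_cross_diff_eq0 f a h b k x eq0 U0 V0 x_gt0 le_a le_b.
rewrite -(ler_nat R) natrM !natrX natrM natr_absz intr_norm => le2.
(* The 2-adic bound is [4 * B ^+ 2 * x^(2d + 2)], and [4 * B ^+ 2 <= x] supplies the last
   exponent. *)
have {}le2 : (2 : R) ^+ (k - h) <= x%:R ^+ (2 * d + 3).
  apply: le_trans le2 _; apply: le_trans (_ : (2 * x%:R) ^+ 2 * (B ^+ 2 * (x%:R ^+ d) ^+ 2) <= _).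
    by rewrite ler_wpM2l // exprn_ge0 // mulr_ge0 // ltW.
  rewrite (_ : _ * _ = 4 * B ^+ 2 * (x%:R ^+ (2 * d + 2))); last first.
    by rewrite exprD mulnC exprM; ring.
  by rewrite (addnS _ 2) [leRHS]exprS ler_wpM2r // exprn_ge0 // ltW.
move: le2; rewrite -ler_ln ?posrE ?exprn_gt0 // !lnXn // -[leLHS]mulr_natl -[leRHS]mulr_natl => le2.
have : (k - h)%:R * (1 / 2) <= (k - h)%:R * ln 2 :> R by rewrite ler_wpM2l // half_le_ln2.
by rewrite natrM; clear -le2; lra.
Qed.

(** * Bounds on prime powers from gaps *)

Lemma natr_le_absz (R : realType) (m : nat) (z : int) :
  (m <= `|z|)%N -> m%:R <= `|z%:~R : R|.
Proof. by rewrite -(ler_nat R) natr_absz intr_norm. Qed.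

(** The integer of [dvd_step] is nonzero, because the falling factorial is at least [a >= eps * x]
    and dominates the bounded ratio [f(a + h) / f(a)]; so [p ^ e] is at most its size. *)
Lemma one_gap_bound (R : realType) (f : {poly int}) (eps c B : R) (d x p e a h : nat) :
  growth_at R f eps c B d x -> 0 < c -> 1 <= x%:R :> R ->
  B < eps * x%:R * c -> 2 * B <= x%:R -> prime p ->
  eps * x%:R <= a%:R -> (0 < h)%N -> (a + h <= x)%N ->
  ((p ^ e)%:Z %| fact_poly f a)%Z -> ((p ^ e)%:Z %| fact_poly f (a + h))%Z ->
  e%:R * ln p%:R <= (h + d + 1)%:R * ln x%:R :> R.
Proof.
move=> [sz _] c0 x1 x_gt x_ge p_pr a_ge h_gt0 le_x da dah.
have p0 : 0 < p%:R :> R by rewrite ltr0n prime_gt0.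
have x0 : 0 < x%:R :> R by apply: lt_le_trans x1.
have ah_ge : eps * x%:R <= (a + h)%:R by apply: le_trans a_ge _; rewrite ler_nat leq_addr.
have /andP[leA geA] := sz a a_ge (leq_trans (leq_addr _ _) le_x).
have /andP[_ geAH] := sz (a + h)%N ah_ge le_x.
have X0 : 0 < (x%:R : R) ^+ d by rewrite exprn_gt0.
have B0 : 0 <= B by rewrite -(pmulr_lge0 _ X0) (le_trans _ geA).
have P1 : eps * x%:R <= ((a + h) ^_ h)%:R.
  by apply: le_trans a_ge _; rewrite ler_nat ffact_ge_base.
have P2 : ((a + h) ^_ h)%:R <= x%:R ^+ h :> R by rewrite -natrX ler_nat ffact_le_expn.
have dz := dvd_step f (p ^ e)%N a h da dah.
set z := (_ - _ : int) in dz.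
have zE : z%:~R = ((a + h) ^_ h)%:R * (f.[a%:Z])%:~R - (f.[(a + h)%:Z])%:~R :> R.
  by rewrite /z intrB intrM.
have Pge0 : 0 <= ((a + h) ^_ h)%:R :> R by [].
have zlow : 0 < `|z%:~R : R|.
  rewrite zE; apply: lt_le_trans (lerB_dist _ _); rewrite subr_gt0 normrM (ger0_norm Pge0).
  apply: le_lt_trans geAH _; apply: lt_le_trans (_ : eps * x%:R * c * x%:R ^+ d <= _).
    by rewrite ltr_pM2r.
  have ex0 : 0 < eps * x%:R by rewrite -(pmulr_lgt0 _ c0) (le_lt_trans B0).
  by rewrite -mulrA; apply: ler_pM => //; [apply: ltW | rewrite mulr_ge0 // ltW].
have zhigh : `|z%:~R : R| <= x%:R ^+ (h + d + 1).
  rewrite zE (le_trans (ler_normB _ _)) // normrM (ger0_norm Pge0).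
  have : ((a + h) ^_ h)%:R * `|(f.[a%:Z])%:~R : R| <= x%:R ^+ h * (B * x%:R ^+ d).
    by rewrite ler_pM.
  have : 1 * (B * x%:R ^+ d) <= x%:R ^+ h * (B * x%:R ^+ d).
    by rewrite ler_wpM2r ?exprn_ege1 // mulr_ge0 // ltW.
  have : 2 * B * (x%:R ^+ h * x%:R ^+ d) <= x%:R * (x%:R ^+ h * x%:R ^+ d).
    by rewrite ler_wpM2r // mulr_ge0 ?exprn_ge0 // ltW.
  by rewrite !exprD expr1; move: geAH; clear; lra.
have z_neq0 : z != 0 by apply: contraTneq zlow => ->; rewrite normr0 ltxx.
have le_pz : (p ^ e <= `|z|)%N by apply: dvdn_leq; rewrite ?absz_gt0 // -[(p ^ e)%N]absz_nat.
have := le_trans (natr_le_absz R _ _ le_pz) zhigh; rewrite natrX => le_px.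
have : ln (p%:R ^+ e) <= ln (x%:R ^+ (h + d + 1)) :> R by rewrite ler_ln ?posrE ?exprn_gt0.
by rewrite !lnXn // [e%:R * _]mulr_natl [(h + d + 1)%:R * _]mulr_natl.
Qed.

Lemma two_gap_bound (R : realType) (f : {poly int}) (eps c B : R) (d x p e t a h b k : nat) :
  growth_at R f eps c B d x -> 0 < c -> 1 <= x%:R :> R -> 2 * B ^+ 2 <= x%:R ->
  prime p -> (h < p)%N -> (0 < t)%N -> (h <= k)%N ->
  eps * x%:R <= a%:R -> eps * x%:R <= b%:R -> (a + h <= x)%N -> (b + k <= x)%N ->
  (forall y : nat, y \in [:: a; a + h; b; b + k]%N -> ((p ^ e)%:Z %| fact_poly f y)%Z) ->
  cross_diff f a h b k != 0 ->
  e%:R * ln p%:R <= h%:R * ln t%:R + x%:R / t%:R + (k - h + (2 * d + 1))%:R * ln x%:R :> R.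
Proof.
move=> gr c0 x1 x_ge p_pr lt_hp t_gt0 le_hk a_ge b_ge le_a le_b dvd nz.
have p0 : 0 < p%:R :> R by rewrite ltr0n prime_gt0.
have t0 : 0 < t%:R :> R by rewrite ltr0n.
have x0 : 0 < x%:R :> R by apply: lt_le_trans x1.
have shift y i : eps * x%:R <= y%:R -> eps * x%:R <= (y + i)%:R.
  by move=> /le_trans -> //; rewrite ler_nat leq_addr.
have := natr_le_absz R _ _ (cross_diff_ge f p e a h b k p_pr le_hk lt_hp dvd nz).
have /andP[_ geU] := growth_at_prod R f eps c B d x b (a + h)%N gr c0 b_ge (shift a h a_ge) (leq_trans (leq_addr _ _) le_b) le_a.
have /andP[_ geV] := growth_at_prod R f eps c B d x a (b + k)%N gr c0 a_ge (shift b k b_ge) (leq_trans (leq_addr _ _) le_a) le_b.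
have Pb : ((b + k) ^_ k)%:R <= x%:R ^+ k :> R by rewrite -natrX ler_nat ffact_le_expn.
have Pa : ((a + h) ^_ h)%:R <= x%:R ^+ k :> R.
  rewrite -natrX ler_nat; apply: leq_trans (ffact_le_expn _ _ _ le_a) _.
  by rewrite leq_pexp2l // -(ltr0n R).
have high : `|(cross_diff f a h b k)%:~R : R| <= x%:R ^+ (k + (2 * d + 1)).
  rewrite /cross_diff intrB [X in X - _]intrM [X in _ - X]intrM (le_trans (ler_normB _ _)) //.
  rewrite normrM [X in _ + X]normrM !(ger0_norm (ler0n _ _)).
  have := ler_pM (ler0n _ _) (normr_ge0 _) Pb geU.
  have := ler_pM (ler0n _ _) (normr_ge0 _) Pa geV.
  have : 2 * B ^+ 2 * (x%:R ^+ k * (x%:R ^+ d) ^+ 2) <= x%:R * (x%:R ^+ k * (x%:R ^+ d) ^+ 2).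
    by rewrite ler_wpM2r // mulr_ge0 ?exprn_ge0 // ltW.
  have -> : x%:R ^+ (k + (2 * d + 1)) = x%:R * (x%:R ^+ k * (x%:R ^+ d) ^+ 2) :> R.
    by rewrite addnA addn1 exprS exprD [(2 * d)%N]mulnC exprM.
  by clear; lra.
move=> /le_trans/(_ high); rewrite natrM => le1.
have y0 : 0 <= x%:R / t%:R :> R by rewrite divr_ge0 // ltW.
(* Replacing [h!] by [(x/t)^h * exp(-x/t)] cancels [x^h] up to [t^h]: this is where [ln t] takes the
   place of [ln x]. *)
have le2 : p%:R ^+ e * (x%:R / t%:R) ^+ h <= x%:R ^+ (k + (2 * d + 1)) * expR (x%:R / t%:R) :> R.
  apply: le_trans (_ : p%:R ^+ e * (h`!%:R * expR (x%:R / t%:R)) <= _).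
    by rewrite ler_wpM2l ?exprn_ge0 ?expr_le_fact_expR // ltW.
  by rewrite mulrA ler_wpM2r ?expR_ge0 // -natrX.
have : ln (p%:R ^+ e * (x%:R / t%:R) ^+ h) <=
       ln (x%:R ^+ (k + (2 * d + 1)) * expR (x%:R / t%:R)) :> R.
  by rewrite ler_ln ?posrE ?mulr_gt0 ?exprn_gt0 ?expR_gt0 ?divr_gt0.
rewrite !lnM ?posrE ?exprn_gt0 ?expR_gt0 ?divr_gt0 // expRK !lnXn ?divr_gt0 //.
rewrite ln_div ?posrE // -[ln p%:R *+ e]mulr_natl -[(_ - _) *+ h]mulr_natl -[ln x%:R *+ _]mulr_natl.
rewrite !natrD natrB //.
by clear; lra.
Qed.

(* The second alternative covers [cross_diff f a h b k = 0]; a parameter [j] larger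
   than [D * ln x] excludes it. *)
Lemma gap_dichotomy (R : realType) (f : {poly int}) (eps : R) :
  f != 0 -> 0 < eps -> eps <= 1 ->
  exists D X1 : R, [/\ 0 < D, expR 1 <= X1 &
    forall x p e t a h b k j : nat,
    X1 <= x%:R -> prime p -> (h < p)%N -> (0 < t)%N -> (0 < h)%N -> (h <= k)%N ->
    eps * x%:R <= a%:R -> eps * x%:R <= b%:R -> (a + h <= x)%N -> (b + k <= x)%N ->
    (a + h <= b)%N || (b + k <= a)%N -> (h == k) || (j <= k - h)%N ->  (0 < j)%N ->
    (forall y : nat, y \in [:: a; a + h; b; b + k]%N -> ((p ^ e)%:Z %| fact_poly f y)%Z) ->
    e%:R * ln p%:R <= h%:R * ln t%:R + x%:R / t%:R + ((k - h)%:R + D) * ln x%:R \/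
    [/\ j%:R <= D * ln x%:R, h%:R ^+ 2 <= D * x%:R * ln x%:R ^+ 2 &
        e%:R * ln p%:R <= (h%:R + D) * ln x%:R]].
Proof.
move=> f0 eps0 eps1; have [d [c [B [X0 [c0 B0 X0_ge gr]]]]] := poly_growth R f eps f0 eps0 eps1.
pose Y := c ^+ 2 * eps.
have Y0 : 0 < Y by rewrite mulr_gt0 // exprn_gt0.
have ec0 : 0 < eps * c by rewrite mulr_gt0.
(* [8d + 14 = 2(4d + 7)] comes from inserting the bound on [k - h] into [cross_diff_eq0_sqr_gap];
   the threshold adds up all lower bounds imposed on [x] below. *)
exists (8 * d + 14)%:R, (X0 + expR 1 + B / Y + B ^+ 2 / Y + B / (eps * c) + 4 * B ^+ 2 + 2 * B).
have e1 := expR_ge1Dx (1 : R).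
have s1 : 0 <= B / Y by rewrite divr_ge0 // ltW.
have s2 : 0 <= B ^+ 2 / Y by rewrite divr_ge0 ?exprn_ge0 // ltW.
have s3 : 0 <= B / (eps * c) by rewrite divr_ge0 // ltW.
have s4 : 0 <= B ^+ 2 by rewrite exprn_ge0.
split; [by rewrite ltr0n addnC | by clear -s1 s2 s3 s4 X0_ge B0; lra |].
move=> x p e t a h b k j x_ge p_pr lt_hp t_gt0 h_gt0 le_hk a_ge b_ge le_a le_b disj alt j_gt0 dvd.
have gx : growth_at R f eps c B d x by apply: gr; clear -x_ge s1 s2 s3 s4 e1 B0; lra.
have x1 : 1 <= x%:R :> R by clear -x_ge s1 s2 s3 s4 e1 B0 X0_ge; lra.
have x0 : 0 < x%:R :> R by apply: lt_le_trans x1.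
have lnx1 : 1 <= ln x%:R :> R.
  by rewrite -[leLHS](expRK 1) ler_ln ?posrE ?expR_gt0 //; clear -x_ge s1 s2 s3 s4 B0 X0_ge; lra.
have b4 : 4 * B ^+ 2 <= x%:R by clear -x_ge s1 s2 s3 s4 e1 B0 X0_ge; lra.
have b2 : 2 * B ^+ 2 <= x%:R by clear -b4 s4; lra.
have b1 : 2 * B <= x%:R by clear -x_ge s1 s2 s3 s4 e1 B0 X0_ge; lra.
have bY : B < Y * x%:R.
  by rewrite mulrC -ltr_pdivrMr //; clear -x_ge s1 s2 s3 s4 e1 B0 X0_ge; lra.
have b2Y : B ^+ 2 < Y * x%:R.
  by rewrite mulrC -ltr_pdivrMr //; clear -x_ge s1 s2 s3 s4 e1 B0 X0_ge; lra.
have bec : B < eps * x%:R * c.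
  rewrite mulrAC mulrC -ltr_pdivrMr //; clear -x_ge s1 s2 s3 s4 e1 B0 X0_ge; lra.
have Yle : Y * x%:R <= c ^+ 2 * x%:R by rewrite ler_pM2r // ler_piMr // exprn_ge0 // ltW.
have [eq0|nz] := eqVneq (cross_diff f a h b k) 0; last first.
  left; apply: le_trans (two_gap_bound R f eps c B d x p e t a h b k gx c0 x1 b2 p_pr lt_hp t_gt0
    le_hk a_ge b_ge le_a le_b dvd nz) _.
  rewrite lerD2l ler_wpM2r //; first by clear -lnx1; lra.
  by rewrite natrD lerD2l ler_nat leq_add // leq_mul2r orbT.
right.
have lt_hk : (h < k)%N.
  (* Equal gaps are excluded by [cross_diff_neq0_same_gap]; if [b] lies left of [a], the pairs are
     swapped first, which only changes the sign. *)
  rewrite ltn_neqAle le_hk andbT; apply/eqP => ehk; move: eq0; rewrite -ehk in le_b disj *.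
  case/orP: disj => [le_ab|le_ba].
    rewrite -(subnKC (_ : a <= b)%N); last by apply: leq_trans le_ab; apply: leq_addr.
    apply/eqP/(cross_diff_neq0_same_gap R f eps c B d x) => //.
    + by apply: lt_le_trans bY Yle.
    + by rewrite subn_gt0; apply: leq_trans le_ab; rewrite -addn1 leq_add2l.
    + by rewrite subnKC //; apply: leq_trans le_ab; apply: leq_addr.
  rewrite (_ : cross_diff f a h b h = - cross_diff f b h a h); last first.
    by rewrite /cross_diff; ring.
  move/eqP; rewrite oppr_eq0.
  rewrite -(subnKC (_ : b <= a)%N); last by apply: leq_trans le_ba; apply: leq_addr.
  apply/negP/(cross_diff_neq0_same_gap R f eps c B d x) => //.
  + by apply: lt_le_trans bY Yle.
  + by rewrite subn_gt0; apply: leq_trans le_ba; rewrite -addn1 leq_add2l.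
  + by rewrite subnKC //; apply: leq_trans le_ba; apply: leq_addr.
have le_ba : (b + k <= a)%N.
  case/orP: disj => // le_ab; move/eqP: eq0; apply: contraLR => _.
  apply: (cross_diff_eq0_gap_order R f eps c B d x) => //.
    by rewrite mulrA.
  by apply: leq_trans le_ab; apply: leq_addr.
have gapln := cross_diff_eq0_gap_le_ln R f eps c B d x a h b k gx c0 x1 b4 a_ge b_ge le_a le_b eq0.
have sqr := cross_diff_eq0_sqr_gap R f eps c B d x a h b k gx c0 x1 (ltW (lt_le_trans b2Y Yle))
  b_ge h_gt0 le_hk le_ba le_a eq0.
have jle : (j <= k - h)%N by move: alt; rewrite ltn_eqF.
have l0 : 0 <= ln x%:R :> R by apply: le_trans lnx1.
have gapln' : (k - h)%:R <= (4 * d%:R + 6) * ln x%:R :> R.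
  by move: gapln; rewrite natrM natrD natrM; clear; lra.
have DE : (8 * d + 14)%:R = 8 * d%:R + 14 :> R by rewrite natrD natrM.
have d0 : 0 <= d%:R * ln x%:R :> R by rewrite mulr_ge0.
split.
- apply: le_trans (_ : (k - h)%:R <= _); first by rewrite ler_nat.
  by rewrite DE; clear -gapln' d0 l0; lra.
- apply: le_trans sqr _; rewrite DE.
  have : x%:R * ln x%:R * ((k - h)%:R + 1) <= x%:R * ln x%:R * ((4 * d%:R + 7) * ln x%:R) :> R.
    by rewrite ler_wpM2l ?mulr_ge0 ?(ltW x0) //; clear -gapln' lnx1; lra.
  by clear; lra.
apply: le_trans (one_gap_bound R f eps c B d x p e a h gx c0 x1 bec b1 p_pr a_ge h_gt0 le_a _ _) _.
- by apply: dvd; rewrite inE eqxx.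
- by apply: dvd; rewrite !inE eqxx orbT.
by rewrite DE !natrD; clear -d0 l0; lra.
Qed.

(** * Summation *)

Lemma min_upto_le (g : nat -> nat) (u j : nat) : (1 <= j <= u)%N -> (min_upto g u <= g j)%N.
Proof.
rewrite /min_upto => hj.
have : j \in index_iota 1 u.+1 by rewrite mem_index_iota.
elim: (index_iota 1 u.+1) => // i s IHs.
rewrite big_cons inE geq_min => /predU1P[->|/IHs->]; first by rewrite leqnn.
by rewrite orbT.
Qed.

Lemma dvd_ordz (p e : nat) (m : int) : prime p -> (e <= ordz p m)%N -> ((p ^ e)%:Z %| m)%Z.
Proof.
move=> p_pr le_e; rewrite dvdzE absz_nat.
have [->|m0] := eqVneq m 0; first by rewrite absz0 dvdn0.
by rewrite pfactor_dvdn // absz_gt0.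
Qed.

(** The enclosing [[l, r[] makes the measure of [J] finite, so that [fine] preserves it, and by
    convexity [J] contains [[u, v]]. *)
Lemma itv_length_ge (R : realType) (J : interval R) (l r u v : R) :
  {subset J <= `[l, r[} -> u \in J -> v \in J -> v - u <= itv_length J.
Proof.
move=> sub uJ vJ; have [lt_vu|le_uv] := ltP v u.
  have : 0 <= itv_length J by rewrite /itv_length fine_ge0.
  by apply: le_trans; lra.
have m1 : (lebesgue_measure [set` `[u, v]] <= lebesgue_measure [set` J])%E.
  apply: le_measure; rewrite ?inE; [exact: measurable_itv | exact: measurable_itv |].
  by move=> y /=; rewrite in_itv /=; apply: (interval_is_interval uJ vJ).
have m2 : (lebesgue_measure [set` J] <= lebesgue_measure [set` `[l, r[])%E.
  apply: le_measure; rewrite ?inE; [exact: measurable_itv | exact: measurable_itv |].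
  by move=> y /=; apply: sub.
have fin : (lebesgue_measure [set` `[l, r[] < +oo)%E.
  by rewrite lebesgue_measure_itv /=; case: ifP => _; rewrite ?ltry // -EFinB ltry.
have finJ : lebesgue_measure [set` J] \is a fin_num.
  by rewrite ge0_fin_numE //; apply: le_lt_trans m2 fin.
have := m1; rewrite lebesgue_measure_itv /= lte_fin.
move: le_uv; rewrite le_eqVlt => /predU1P[->|lt_uv].
  by rewrite subrr => _; rewrite /itv_length fine_ge0.
by rewrite lt_uv -EFinB => le1; rewrite -lee_fin /itv_length fineK.
Qed.

Lemma ln_le_root (R : realType) (x : R) (k : nat) :
  0 < x -> (0 < k)%N -> ln x <= k%:R * x `^ k%:R^-1.
Proof.
move=> x0 k_gt0; have y0 : 0 < x `^ k%:R^-1 by rewrite powR_gt0.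
have e : ln x = k%:R * ln (x `^ k%:R^-1).
  by rewrite ln_powR mulrA divff ?mul1r // pnatr_eq0 -lt0n.
rewrite e ler_wpM2l //.
have := @le_ln1Dx R (x `^ k%:R^-1 - 1) ltac:(lra).
by rewrite addrC subrK; lra.
Qed.

Lemma ln_pow4_le_sqrt (R : realType) (x : R) :
  1 <= x -> ln x ^+ 4 <= 4096 * Num.sqrt x.
Proof.
move=> x1; have x0 : 0 < x by lra.
(* The fourth power of the eighth root is the square root, and [8^4 = 4096]. *)
have := @ln_le_root R x 8 x0 isT; set y := x `^ _ => le_y.
have y0 : 0 <= y by rewrite powR_ge0.
have -> : Num.sqrt x = y ^+ 4.
  have <- : (y ^+ 4) ^+ 2 = x.
    by rewrite -exprM /= -powR_mulrn // -powRrM mulVf ?powRr1 ?pnatr_eq0 // ltW.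
  by rewrite sqrtr_sqr ger0_norm // exprn_ge0.
have l0 : 0 <= ln x by rewrite ln_ge0.
have := @lerXn2r R 4 (ln x) (8%:R * y); rewrite !nnegrE => /(_ l0) h.
apply: le_trans (h _ le_y) _; first by rewrite mulr_ge0.
by rewrite exprMn; clear; lra.
Qed.

(** The cube root absorbs the logarithm. This turns [t <= C0 * x^(2/3)] into [t * ln x = O(x)]. *)
Lemma powR_two_thirds_ln_le (R : realType) (x : R) :
  1 <= x -> x `^ (2 / 3) * ln x <= 3 * x.
Proof.
move=> x1; have x0 : 0 < x by lra.
have le1 := @ln_le_root R x 3 x0 isT.
apply: le_trans (_ : x `^ (2 / 3) * (3%:R * x `^ 3%:R^-1) <= _).
  by rewrite ler_wpM2l // powR_ge0.
rewrite mulrCA -powRD; last by apply/implyP => _; rewrite gt_eqF.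
rewrite (_ : 2 / 3 + _ = 1) ?powRr1 ?(ltW x0) //; lra.
Qed.

Lemma sum_term_bound (R : realType) (E : nat -> nat) (G : nat -> nat) (T t N : nat)
    (lp A W : R) :
  0 <= A -> 0 <= W -> (0 < T)%N ->
  (\sum_(T <= u < t.+1) (G u).*2 <= N)%N ->
  (forall u : nat, (T <= u <= t)%N -> (E u)%:R * lp <= (G u)%:R * A + W) ->
  lp * (\sum_(T <= u < t.+1) E u)%:R <= N%:R / 2 * A + t%:R * W.
Proof.
move=> A0 W0 T_gt0 leN bnd.
apply: le_trans (_ : \sum_(T <= u < t.+1) ((G u)%:R * A + W) <= _).
  rewrite natr_sum mulr_sumr; apply: ler_sum_nat => u /andP[le_Tu lt_ut].
  by rewrite mulrC bnd // le_Tu.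
rewrite big_split /= -mulr_suml lerD //.
  rewrite ler_wpM2r // ler_pdivlMr // -natr_sum -natrM ler_nat (leq_trans _ leN) //.
  by rewrite big_distrl /= leq_sum // => u _; rewrite muln2.
(* Since [T] is positive, the sum has at most [t] terms. *)
by rewrite sumr_const_nat -[leLHS]mulr_natl ler_wpM2r // ler_nat leq_subLR -add1n leq_add2r.
Qed.

(** [n j0 - n i0] stands for the length of [J]. The parameters stay free for two regimes: either [j]
    exceeds [D * ln x], which rules out vanishing and permits [W = 0], or [W] must be of size
    [sqrt (D * x)]. *)
Lemma ordz_sum_bound (R : realType) (f : {poly int}) (eps : R) :
  f != 0 -> 0 < eps -> eps <= 1 ->
  exists D X1 : R, [/\ 0 < D, expR 1 <= X1 &
    forall (x p t s T : nat) (n : nat -> nat),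
    X1 <= x%:R -> prime p -> (0 < T <= t)%N -> (t + s + 3 <= T.*2)%N ->
    (forall j : nat, (1 <= j <= t)%N -> [/\ eps * x%:R <= (n j)%:R, (n j < x)%N & (n j < p)%N]) ->
    (forall i j : nat, (1 <= i <= t)%N -> (1 <= j <= t)%N -> n i = n j -> i = j) ->
    exists i0 j0 : nat, [/\ (1 <= i0 <= t)%N, (1 <= j0 <= t)%N, (n i0 <= n j0)%N &
    forall (j q : nat) (W : R), (0 < j)%N -> (0 < q)%N -> (j * q <= s)%N -> 0 <= W ->
      (j%:R <= D * ln x%:R -> D * x%:R <= W ^+ 2) ->
      ln p%:R * (\sum_(T <= u < t.+1) min_upto (fun j => ordz p (fact_poly f (n j))) u)%:R
       <= (n j0 - n i0)%:R / 2 * (ln t%:R + ln x%:R / q%:R) +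
          t%:R * (x%:R / t%:R + D * ln x%:R + W * ln x%:R ^+ 2)]].
Proof.
move=> f0 eps0 eps1; have [D [X1 [D0 X1_ge dich]]] := gap_dichotomy R f eps f0 eps0 eps1.
exists D, X1; split=> // x p t s T n x_ge p_pr /andP[T_gt0 le_Tt] le_T rng inj_n.
have t_gt0 : (0 < t)%N by apply: leq_trans le_Tt.
have [G [[i0 [j0 [hi0 hj0 le_ij sumG]]] gaps]] := close_gaps n t s T inj_n t_gt0 le_Tt le_T.
exists i0, j0; split=> // j q W j_gt0 q_gt0 le_jq W0 alt.
have x1 : 1 <= x%:R :> R by have := expR_ge1Dx (1 : R); lra.
have L0 : 0 <= ln x%:R :> R by rewrite ln_ge0.
have lt0 : 0 <= ln t%:R :> R by rewrite ln_ge0 // ler1n.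
have q0 : 0 < q%:R :> R by rewrite ltr0n.
apply: (sum_term_bound _ _ G) => //.
- by rewrite addr_ge0 // divr_ge0.
- by rewrite !addr_ge0 ?divr_ge0 ?mulr_ge0 ?exprn_ge0 // ltW.
move=> u hu; have /andP[le_Tu le_ut] := hu.
have [a [h [b [k [[h_gt0 le_hk le_kG le_d alt2] disj pts]]]]] := gaps u j q hu j_gt0 q_gt0 le_jq.
set E := min_upto _ u.
have dvdE y : y \in [:: a; a + h; b; b + k]%N -> ((p ^ E)%:Z %| fact_poly f y)%Z.
  move=> /pts[i hi <-]; apply: dvd_ordz => //; exact: min_upto_le.
have ptsR y : y \in [:: a; a + h; b; b + k]%N ->
    [/\ eps * x%:R <= y%:R, (y < x)%N & (y < p)%N].
  move=> /pts[i /andP[i_gt0 le_iu] <-]; apply: rng.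
  by rewrite i_gt0 (leq_trans le_iu).
have [a_ge _ _] := ptsR a ltac:(by rewrite !inE eqxx).
have [_ ah_x ah_p] := ptsR (a + h)%N ltac:(by rewrite !inE eqxx orbT).
have [b_ge _ _] := ptsR b ltac:(by rewrite !inE eqxx !orbT).
have [_ bk_x _] := ptsR (b + k)%N ltac:(by rewrite !inE eqxx !orbT).
have h_lt_p : (h < p)%N by apply: leq_ltn_trans ah_p; apply: leq_addl.
have hG : h%:R <= (G u)%:R :> R by rewrite ler_nat (leq_trans le_hk).
have dG : (k - h)%:R <= (G u)%:R / q%:R :> R.
  rewrite ler_pdivlMr // -natrM ler_nat; apply: leq_trans (leq_divM (G u) q).
  by rewrite leq_mul2r le_d orbT.
have WL : 0 <= W * ln x%:R ^+ 2 by rewrite mulr_ge0 // exprn_ge0.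
have xt : 0 <= x%:R / t%:R :> R by rewrite divr_ge0.
have Gt : 0 <= (G u)%:R * ln t%:R :> R by rewrite mulr_ge0.
have Gq : 0 <= (G u)%:R / q%:R * ln x%:R :> R by rewrite mulr_ge0 // divr_ge0.
have [le1|[le_j le_h le1]] := dich x p E t a h b k j x_ge p_pr h_lt_p t_gt0 h_gt0 le_hk
  a_ge b_ge (ltnW ah_x) (ltnW bk_x) disj alt2 j_gt0 dvdE.
  have i1 : h%:R * ln t%:R <= (G u)%:R * ln t%:R :> R by rewrite ler_wpM2r.
  have i2 : (k - h)%:R * ln x%:R <= (G u)%:R / q%:R * ln x%:R :> R by rewrite ler_wpM2r.
  by clear -le1 i1 i2 WL; lra.
(* In the vanishing alternative the squared gap is at most [D * x * ln x ^+ 2], hence at most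
   [(W * ln x) ^+ 2]. *)
have hW : h%:R <= W * ln x%:R.
  rewrite -ler_sqr ?nnegrE ?mulr_ge0 // exprMn (le_trans le_h) //.
  by rewrite ler_wpM2r ?exprn_ge0 // alt.
have i1 : h%:R * ln x%:R <= W * ln x%:R * ln x%:R by rewrite ler_wpM2r.
by clear -le1 i1 Gt Gq xt; lra.
Qed.

(** Split off [t^0.02], which is at least [(10/eps)^2], hence at least [4/eps]. *)
Lemma powR_098_le (R : realType) (eps t : R) :
  0 < eps -> eps <= 1 -> (10 / eps) ^+ 100 <= t -> t `^ (98 / 100) <= eps * t / 4.
Proof.
move=> eps0 eps1 t_ge.
have y0 : 0 < 10 / eps by rewrite divr_gt0.
have t0 : 0 < t by apply: lt_le_trans t_ge; rewrite exprn_gt0.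
have e : t = t `^ (98 / 100) * t `^ (2 / 100).
  rewrite -powRD; last by apply/implyP => _; rewrite gt_eqF.
  by rewrite (_ : 98 / 100 + _ = 1) ?powRr1 ?(ltW t0) //; lra.
have le2 : (10 / eps) ^+ 2 <= t `^ (2 / 100).
  have -> : (10 / eps) ^+ 2 = ((10 / eps) ^+ 100) `^ (2 / 100).
    rewrite -!powR_mulrn ?(ltW y0) // -powRrM; congr (_ `^ _); lra.
  by rewrite ge0_ler_powR ?nnegrE ?exprn_ge0 ?(ltW y0) ?(ltW t0) //; lra.
have tau0 : 0 < t `^ (98 / 100) by rewrite powR_gt0.
rewrite {2}e mulrCA -mulrA ler_peMr ?(ltW tau0) //.
have : eps * (10 / eps) ^+ 2 <= eps * t `^ (2 / 100) by rewrite ler_pM2l.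
have -> : eps * (10 / eps) ^+ 2 = 100 / eps by field; rewrite gt_eqF.
have : 100 <= 100 / eps by rewrite ler_pdivlMr //; lra.
by lra.
Qed.

Theorem lemma2p7 (R : realType) (f : {poly int}) (C0 eps0 : R)
    (f_neq0 : f != 0)
    (C0_gt0 : 0 < C0) (C0_bound : root_count_bound f C0)
    (eps0_gt0 : 0 < eps0) (eps0_lt : eps0 < 1 / 100) :
  exists x0 K : R, [/\ 0 < x0, 0 < K &
    forall (x p t : nat) (J : interval R) (n : nat -> nat),
      x0 <= x%:R ->
      prime p ->
      (10 / eps0) ^+ 100 <= t%:R ->
      t%:R <= C0 * x%:R `^ (2 / 3) ->
      {subset J <= `[eps0 * x%:R, Num.min x%:R p%:R[} ->
      (forall j : nat, (1 <= j <= t)%N -> (n j)%:R \in J) ->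
      (forall i j : nat, (1 <= i <= t)%N -> (1 <= j <= t)%N ->
         n i = n j -> i = j) ->
      ln p%:R *
        (\sum_(`|Num.ceil ((1 + eps0) / 2 * t%:R)|%N <= t' < t.+1)
           min_upto (fun j => ordz p (fact_poly f (n j))) t')%:R
      <= itv_length J / 2 * ln t%:R
         + x%:R * ln x%:R / t%:R `^ (98 / 100)
         + K * x%:R].
Proof.
clear C0_bound.
have eps1 : eps0 <= 1 by lra.
have [D [X1 [D0 X1_ge bnd]]] := ordz_sum_bound R f eps0 f_neq0 eps0_gt0 eps1.
have D10 : 0 < D + 1 by lra.
(* Chosen so that [t > M * ln x ^+ 2] gives [s > (D + 1) * ln x ^+ 2], as [s >= eps0 * t / 8]. *)
pose M := 8 * (D + 1) / eps0.
have M0 : 0 < M by rewrite divr_gt0 // mulr_gt0.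
have K1 : 0 < D * C0 by rewrite mulr_gt0.
have K2 : 0 <= M * Num.sqrt D by rewrite mulr_ge0 ?sqrtr_ge0 // ltW.
(* In [K], the 2 covers [t * (x/t)] and the pigeonhole error for large [t]; the second term covers
   [t * D * ln x], the third the vanishing alternative for small [t]. *)
exists X1, (2 + 3 * (D * C0) + 4096 * (M * Num.sqrt D)); split.
- by apply: lt_le_trans X1_ge; rewrite expR_gt0.
- by lra.
move=> x p t J n x_ge p_pr t_ge t_le subJ nJ inj_n.
have x_e : expR 1 <= x%:R :> R by apply: le_trans x_ge.
have x1 : 1 <= x%:R :> R by have := expR_ge1Dx (1 : R); lra.
have x0 : 0 < x%:R :> R by lra.
have L1 : 1 <= ln x%:R :> R by rewrite -[leLHS](expRK 1) ler_ln ?posrE ?expR_gt0.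
have L0 : 0 <= ln x%:R :> R by apply: le_trans L1.
have tau_le := powR_098_le R eps0 t%:R eps0_gt0 eps1 t_ge.
have t_ge10 : 10 <= eps0 * t%:R.
  have y1 : 1 <= 10 / eps0 by rewrite ler_pdivlMr //; lra.
  have : 10 / eps0 <= t%:R.
    by apply: le_trans t_ge; rewrite -[leLHS]expr1 ler_weXn2l.
  by rewrite ler_pdivrMr // mulrC.
have t0 : 0 < t%:R :> R by rewrite -(pmulr_rgt0 _ eps0_gt0); lra.
(* Small enough that [s + 3 <= eps0 * t], as the count of present pairs requires, and large enough
   that [t^0.98 <= 2 * s]. *)
pose s := Num.truncn (eps0 * t%:R / 4).
have /andP[s_le s_gt] : (s%:R <= eps0 * t%:R / 4 < s.+1%:R).
  by apply: truncn_itv; lra.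
rewrite -[s.+1%:R]natr1 in s_gt; clearbody s.
have s_ge : eps0 * t%:R / 8 <= s%:R by lra.
have s0 : 0 < s%:R :> R by lra.
set T := `|_|%N.
have T_ge : (1 + eps0) / 2 * t%:R <= T%:R.
  have y0 : 0 <= (1 + eps0) / 2 * t%:R by rewrite mulr_ge0 // ?ltW //; lra.
  rewrite natr_absz ger0_norm ?ceil_ge //.
  by rewrite -(ler_int R) (le_trans y0) // ceil_ge.
have T_le : (T <= t)%N.
  rewrite -lez_nat gez0_abs; last first.
    by rewrite -(ler_int R) (le_trans _ (ceil_ge _)) // mulr_ge0 // ?ltW //; lra.
  by rewrite ceil_le_int ler_piMl // ?ltW //; lra.
have T_gt0 : (0 < T)%N.
  by rewrite -(ltr0n R) (lt_le_trans _ T_ge) // mulr_gt0 //; lra.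
have le_T : (t + s + 3 <= T.*2)%N.
  by rewrite -(ler_nat R) -muln2 natrM !natrD; lra.
have rng j : (1 <= j <= t)%N -> [/\ eps0 * x%:R <= (n j)%:R, (n j < x)%N & (n j < p)%N].
  move=> /nJ/subJ; rewrite in_itv /= lt_min !ltr_nat => /and3P[-> -> ->] //.
have [i0 [j0 [hi0 hj0 le_ij main]]] :=
  bnd x p t s T n x_ge p_pr ltac:(by rewrite T_gt0 T_le) le_T rng inj_n.
have NJ : (n j0 - n i0)%:R <= itv_length J :> R.
  by rewrite natrB //; apply: itv_length_ge subJ _ _; apply: nJ.
have Nx : (n j0 - n i0)%:R <= x%:R :> R.
  have [_ lt_x _] := rng j0 hj0; rewrite ler_nat.
  by apply: leq_trans (leq_subr _ _) (ltnW lt_x).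
have N0 : 0 <= (n j0 - n i0)%:R :> R by [].
move: (n j0 - n i0)%:R NJ Nx N0 main => N NJ Nx N0 main.
have lt0 : 0 <= ln t%:R :> R by rewrite ln_ge0 // ler1n -(ltr0n R).
have i1 : N / 2 * ln t%:R <= itv_length J / 2 * ln t%:R.
  by rewrite ler_wpM2r // ler_wpM2r.
have i2 : t%:R * (x%:R / t%:R) = x%:R :> R by field; rewrite gt_eqF.
have i3 : t%:R * (D * ln x%:R) <= 3 * (D * C0) * x%:R.
  have : t%:R * ln x%:R <= C0 * x%:R `^ (2 / 3) * ln x%:R by rewrite ler_wpM2r.
  have := ler_wpM2l (ltW C0_gt0) (powR_two_thirds_ln_le R x%:R x1) => a1 a2.
  have : D * (t%:R * ln x%:R) <= D * (C0 * (3 * x%:R)).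
    by rewrite ler_wpM2l ?(ltW D0) //; lra.
  by lra.
have tau0 : 0 < t%:R `^ (98 / 100) :> R by rewrite powR_gt0.
have MsD : 0 <= M * Num.sqrt D * x%:R by rewrite mulr_ge0 // ltW.
have xL0 : 0 <= x%:R * ln x%:R / t%:R `^ (98 / 100) :> R.
  by rewrite divr_ge0 ?mulr_ge0 // ltW.
have [tM|tM] := leP t%:R (M * ln x%:R ^+ 2).
  (* Small [t]: [j = 1] and [q = s] give the finest pigeonhole, whose error is the term with
     [t^0.98]. Vanishing remains possible and costs [t * sqrt (D * x) * ln x ^+ 2], which is
     [O(x)]. *)
  have := main 1%N s (Num.sqrt (D * x%:R)) isT ltac:(by rewrite -(ltr0n R))
    ltac:(by rewrite mul1n) (sqrtr_ge0 _).
  rewrite sqr_sqrtr; last by rewrite mulr_ge0 // ltW.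
  move=> /(_ (fun=> lexx _)) main1.
  have i4 : N / 2 * (ln x%:R / s%:R) <= x%:R * ln x%:R / t%:R `^ (98 / 100).
    have : N * (ln x%:R / (2 * s%:R)) <= x%:R * (ln x%:R / t%:R `^ (98 / 100)).
      rewrite ler_pM ?divr_ge0 ?mulr_ge0 ?(ltW s0) //.
      by rewrite ler_wpM2l // lef_pV2 ?posrE ?mulr_gt0 //; lra.
    by rewrite invfM; lra.
  have i5 : t%:R * (Num.sqrt (D * x%:R) * ln x%:R ^+ 2) <= 4096 * (M * Num.sqrt D) * x%:R.
    have W0 := sqrtr_ge0 (D * x%:R).
    have : t%:R * (Num.sqrt (D * x%:R) * ln x%:R ^+ 2) <=
        M * ln x%:R ^+ 2 * (Num.sqrt (D * x%:R) * ln x%:R ^+ 2).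
      by rewrite ler_wpM2r // mulr_ge0 // exprn_ge0.
    rewrite sqrtrM ?(ltW D0) //.
    have := ler_wpM2l (mulr_ge0 K2 (sqrtr_ge0 x%:R)) (ln_pow4_le_sqrt R x%:R x1).
    have : M * Num.sqrt D * (Num.sqrt x%:R * Num.sqrt x%:R) = M * Num.sqrt D * x%:R.
      by rewrite -expr2 sqr_sqrtr // ltW.
    by clear; lra.
  by clear -main1 i1 i2 i3 i4 i5 x0; lra.
pose j := (Num.truncn (D * ln x%:R)).+1.
have DL0 : 0 <= D * ln x%:R by rewrite mulr_ge0 // ltW.
have /andP[j_le j_gt] := truncn_itv DL0.
have jLe : j%:R <= (D + 1) * ln x%:R by rewrite /j -natr1; lra.
have tM' : 8 * (D + 1) * ln x%:R ^+ 2 < eps0 * t%:R.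
  by move: tM; rewrite /M mulrAC ltr_pdivrMr // [t%:R * _]mulrC.
have L12 : (D + 1) * ln x%:R <= (D + 1) * ln x%:R ^+ 2.
  by rewrite ler_pM2l ?ler_eXnr //; lra.
have le_js : (j <= s)%N by rewrite -(ler_nat R); lra.
pose q := (s %/ j)%N.
have q_gt0 : (0 < q)%N by rewrite divn_gt0.
have le_jq : (j * q <= s)%N by rewrite mulnC leq_divM.
have sq : s%:R <= 2 * q%:R * j%:R :> R.
  rewrite -!natrM ler_nat; apply/ltnW/(leq_trans (ltn_ceil s (isT : 0 < j)%N)).
  by rewrite leq_mul2r -/q; apply/orP; right; clear -q_gt0; lia.
have q0 : 0 < q%:R :> R by rewrite ltr0n.
(* Compare [(D + 1) * ln x ^+ 2 < s] with [s <= 2 * q * j] and [j <= (D + 1) * ln x]. *)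
have Lq : ln x%:R <= 2 * q%:R :> R.
  have le_qj : 2 * q%:R * j%:R <= 2 * q%:R * ((D + 1) * ln x%:R) by rewrite ler_wpM2l ?mulr_ge0.
  have DL : 0 < 8 * (D + 1) * ln x%:R.
    by rewrite mulr_gt0 ?(lt_le_trans _ L1) // mulr_gt0.
  by rewrite -(ler_pM2l DL); clear -tM' s_ge sq le_qj; lra.
have main2 := main j q 0 isT q_gt0 le_jq (lexx _).
have {}main2 := main2 ltac:(by move=> /(lt_le_trans j_gt); rewrite ltxx).
have i4 : N / 2 * (ln x%:R / q%:R) <= x%:R.
  have : N * (ln x%:R / (2 * q%:R)) <= x%:R * 1.
    by rewrite ler_pM ?divr_ge0 ?mulr_ge0 // ler_pdivrMr ?mul1r ?mulr_gt0.
  by rewrite invfM; lra.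
by clear -main2 i1 i2 i3 i4 MsD xL0; lra.
Qed.
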